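(* Let $\Sigma$ be a complete $n$-dimensional smooth manifold, let $V$ be a constant vector field on $\mathbb{R}^N$, and let $F:\Sigma\times[0,T)\rightarrow\mathbb{R}^N$ be a smooth family of immersions satisfying $$\frac{d}{dt}F(p,t)=H+V^T,\qquad p\in\Sigma,\ t\in[0,T),$$ where $H$ is the mean curvature vector of $M_t=F(\Sigma,t)$ at $F(p,t)$ and $V^T$ is the tangential part of $V$ along $M_t$ at $F(p,t)$. Then, for every $t$, at every point $p\in\Sigma$, $$\frac{d}{dt}\left(e^{\langle F(p,t)-tV,V\rangle}\,d\mu_t\right)=-|H-V^\perp|^2\,e^{\langle F(p,t)-tV,V\rangle}\,d\mu_t .$$ Moreover, for every relatively compact domain $\widetilde{\Sigma}\subset\Sigma$, writing $\widetilde{M}_t=F(\widetilde{\Sigma},t)$ and $$\Phi_V(\widetilde{\Sigma},t)=\int_{\widetilde{M}_t}e^{\langle x-tV,V\rangle}\,d\mu_t ,$$ one has $$\frac{d}{dt}\Phi_V(\widetilde{\Sigma},t)=-\int_{\widetilde{M}_t}|H-V^\perp|^2\,e^{\langle x-tV,V\rangle}\,d\mu_t .$$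
   Context: $\langle\cdot,\cdot\rangle$ is the Euclidean metric on $\mathbb{R}^N$ and $\overline{\nabla}$ its Levi-Civita connection. For a family of immersions $F(\cdot,t):\Sigma\to\mathbb{R}^N$ and local coordinates $(x^i)$ on $\Sigma$, put $F_i=dF_t(\partial/\partial x^i)$. The induced metric is $g_{ij}=\langle F_i,F_j\rangle$, the second fundamental form is $A_{ij}=(\overline{\nabla}_{F_i}F_j)^\perp$, and the mean curvature vector is $H=g^{ij}A_{ij}$ (the trace, not the average). The superscripts $T$ and $\perp$ denote the orthogonal projections onto the tangent space and normal space of $M_t$. $d\mu_t$ is the volume element of the induced metric, regarded both on $\Sigma$ and on $M_t$. The letter $x=F(p,t)$ denotes the position vector. Integrals over $\widetilde{M}_t$ are understood as integrals over $\widetilde{\Sigma}$ via $F(\cdot,t)$, e.g. $\int_{\widetilde{M}_t}e^{\langle x-tV,V\rangle}d\mu_t=\int_{\widetilde{\Sigma}}e^{\langle F(p,t)-tV,V\rangle}d\mu_t$. The time derivative of the $t$-dependent measure $e^{\langle F(p,t)-tV,V\rangle}d\mu_t$ on $\Sigma$ is the derivative of its density with respect to a fixed ($t$-independent) local volume element, e.g. $d\mu_t=\sqrt{\det g_{ij}(p,t)}\,dx^1\cdots dx^n$ in fixed local coordinates on $\Sigma$. *)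

(* Defs.v *)
From HB Require Import structures.
From mathcomp Require Import all_boot all_order all_algebra.
From mathcomp Require Import all_classical all_reals all_analysis.

Set Implicit Arguments.
Unset Strict Implicit.
Unset Printing Implicit Defensive.

Import Order.TTheory GRing.Theory Num.Theory.
Import numFieldNormedType.Exports.

Local Open Scope classical_set_scope.
Local Open Scope ring_scope.

Notation borel S := (g_sigma_algebraType (@open S)).

Section lebesgue_rV.
Variable R : realType.

Definition cons_rV (n : nat) (p : measurableTypeR R * borel 'rV[R]_n) :
    borel 'rV[R]_n.+1 :=
  row_mx (p.1%:M : 'rV_1) (p.2 : 'rV_n).

(* lebesgue_rV n.+1 is the product of the Lebesgue measures on R and R^n. *)
Fixpoint lebesgue_rV (n : nat) : set (borel 'rV[R]_n) -> \bar R :=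
  match n with
  | 0 => @dirac _ (borel 'rV[R]_0) (0 : 'rV[R]_0) R
  | m.+1 => pushforward
      (product_measure1 lebesgue_measure (@lebesgue_rV m)) (@cons_rV m)
  end.

Lemma cons_rV0 (n : nat) p : (@cons_rV n p : 'rV[R]_n.+1) 0 0 = p.1.
Proof.
case: p => a y; transitivity ((a%:M : 'M[R]_1) 0 0); last by rewrite mxE.
rewrite -(@row_mxEl R 1 1 n a%:M y 0 0).
by congr (fun_of_matrix _ 0); apply/val_inj.
Qed.

Lemma cons_rVS (n : nat) p (j : 'I_n) :
  (@cons_rV n p : 'rV[R]_n.+1) 0 (lift 0 j) = (p.2 : 'rV[R]_n) 0 j.
Proof.
case: p => a y; rewrite -[RHS](@row_mxEr R 1 1 n a%:M y 0 j).
by congr (fun_of_matrix _ 0); apply/val_inj.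
Qed.

Lemma preimage_cons_rV_ball (n : nat) (x : 'rV[R]_n.+1) (e : R) :
  @cons_rV n @^-1` ball x e =
  (ball (x 0 0 : R) e `*` ball (\row_j x 0 (lift 0 j) : 'rV[R]_n) e).
Proof.
apply/seteqP; split=> [[a y] [e0 h]|[a y] [/= ha [e0 hy]]].
  split=> /=; first by have := h 0 0; rewrite cons_rV0.
  split=> // i j; have := h i (lift 0 j).
  by rewrite (ord1 i) cons_rVS mxE.
split=> // i j; rewrite (ord1 i); case: (unliftP 0 j) => [l ->|->].
  by rewrite cons_rVS; have := hy 0 l; rewrite mxE.
by rewrite cons_rV0.
Qed.

Lemma measurable_rV_ball (n : nat) (x : 'rV[R]_n) (e : R) :
  measurable (ball x e : set (borel 'rV[R]_n)).
Proof.
by apply: sub_sigma_algebra; apply: ball_open_nbhs || exact: ball_open.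
Qed.

Lemma measurable_cons_rV (n : nat) : measurable_fun setT (@cons_rV n).
Proof.
pose cen (q : 'rV[rat]_n.+1) : 'rV[R]_n.+1 := \row_i ratr (q 0 i).
pose rad (k : nat) : R := k.+1%:R^-1.
have rad0 k : 0 < rad k by rewrite invr_gt0.
refine (@measurability _ _ _ (borel 'rV[R]_n.+1) setT (@cons_rV n)
  (@open 'rV[R]_n.+1) erefl _) => _ [A oA <-].
rewrite setTI.
pose I := [set qk : 'rV[rat]_n.+1 * nat | ball (cen qk.1) (rad qk.2) `<=` A].
have -> : A = \bigcup_(qk in I) ball (cen qk.1) (rad qk.2).
  apply/seteqP; split=> [x Ax|x [qk /= qkA]]; last exact: qkA.
  have /nbhs_ballP[e /= e0 eA] : nbhs (x : 'rV[R]_n.+1) A.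
    by rewrite nbhsE; exists A.
  have [k _ ke] : exists2 k, True & rad k < e / 2.
    have e20 : 0 < e / 2 by rewrite divr_gt0.
    exists (Num.truncn (e / 2)^-1) => //.
    by rewrite /rad invf_plt ?posrE//; apply: truncnS_gt.
  have /choice[q hq] : forall i : 'I_n.+1,
      exists q : rat, `|ratr q - (x : 'rV[R]_n.+1) 0 i| < rad k.
    move=> i; set xi := _ 0 i; have : xi - rad k < xi + rad k.
      by rewrite ltrBlDr -addrA ltrDl addr_gt0.
    move=> /rat_in_itvoo[q]; rewrite in_itv/= => /andP[q1 q2]; exists q.
    by rewrite ltr_distl q1 q2.
  pose qk := ((\row_i q i : 'rV[rat]_n.+1), k).
  have xq i j : ball (cen qk.1 i j) (rad k) ((x : 'rV[R]_n.+1) i j).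
    by rewrite (ord1 i) /ball/= !mxE; exact: hq.
  exists qk; last by split.
  move=> /= y [_ qy]; apply: eA; split => // i j.
  rewrite (splitr e); apply: (@ball_triangle _ _ (cen qk.1 i j)).
    by apply: ball_sym; apply: le_ball (xq i j); exact: ltW.
  by apply: le_ball (qy i j); exact: ltW.
rewrite bigcup_mkcond preimage_bigcup; apply: countable_bigcupT_measurable.
  exact: countableP.
move=> [q k] /=; case: ifPn => _; last by rewrite preimage_set0.
rewrite preimage_cons_rV_ball; apply: measurableX; first exact: measurable_realfun.measurable_ball.
exact: measurable_rV_ball.
Qed.

Lemma lebesgue_rV_spec (n : nat) :
  exists2 m : {sigma_finite_measure set (borel 'rV[R]_n) -> \bar R},
    @lebesgue_rV n = m & forall e : R, (m (ball (0%R : 'rV[R]_n) e) < +oo)%E.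
Proof.
elim: n => [|n [m IH mfin]].
  exists (@dirac _ (borel 'rV[R]_0) (0 : 'rV[R]_0) R) => // e.
  by rewrite /= diracE ltry.
have mc := @measurable_cons_rV n.
pose P := pushforward (lebesgue_measure \x m)%E (@cons_rV n).
have P0 : P set0 = 0%E by rewrite /P /pushforward preimage_set0 measure0.
have Pge A : (0 <= P A)%E by exact: measure_ge0.
have Psa : semi_sigma_additive P.
  move=> F mF tF mUF; rewrite /P /pushforward preimage_bigcup.
  apply: measure_semi_sigma_additive.
  - by move=> k; rewrite -[X in measurable X]setTI; exact: mc.
  - apply/trivIsetP => /= i j _ _ ij; rewrite -preimage_setI.
    by move/trivIsetP : tF => /(_ _ _ _ _ ij) ->//; rewrite preimage_set0.
  - by rewrite -preimage_bigcup -[X in measurable X]setTI; exact: mc.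
have Pfin e : (P (ball (0%R : 'rV[R]_n.+1) e) < +oo)%E.
  rewrite /P /pushforward preimage_cons_rV_ball product_measure1E//=; last 2 first.
  - exact: measurable_realfun.measurable_ball.
  - exact: measurable_rV_ball.
  rewrite (_ : \row_j _ = 0); last by apply/rowP => j; rewrite !mxE.
  rewrite mxE; have [e0|e0] := leP e 0.
    have -> : ball (0%R : R) e = set0 by exact/ball0.
    by rewrite measure0 mul0e ltry.
  rewrite lte_mul_pinfty ?mfin// lebesgue_measure_ball ?ltW//.
have Psf : sigma_finite setT P.
  exists (fun k => ball (0 : 'rV[R]_n.+1) k%:R).
    apply/seteqP; split => // x _; exists (Num.truncn `|x|).+1 => //.
    by rewrite -ball_normE /ball_/= sub0r normrN truncnS_gt.
  by move=> k; split; [exact: measurable_rV_ball|exact: Pfin].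
rewrite /= IH -/P; clearbody P.
pose M1 := isMeasure.Build _ _ _ P P0 Pge Psa.
pose M2 : {measure set (borel 'rV[R]_n.+1) -> \bar R} := HB.pack P M1.
pose M3 := Measure_isSigmaFinite.Build _ _ _ M2 Psf.
pose M4 : {sigma_finite_measure set (borel 'rV[R]_n.+1) -> \bar R} :=
  HB.pack P M1 M3.
by exists M4.
Qed.

Section instances.
Variable n : nat.

Let mu0 : @lebesgue_rV n set0 = 0%E.
Proof. by have [m ->] := lebesgue_rV_spec n. Qed.

Let mu_ge0 A : (0 <= @lebesgue_rV n A)%E.
Proof. by have [m -> _] := lebesgue_rV_spec n. Qed.

Let mu_sigma_additive : semi_sigma_additive (@lebesgue_rV n).
Proof.
have [m -> _] := lebesgue_rV_spec n; exact: measure_semi_sigma_additive.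
Qed.

Let mu_sigma_finite : sigma_finite setT (@lebesgue_rV n).
Proof. have [m -> _] := lebesgue_rV_spec n; exact: sigma_finiteT. Qed.

HB.instance Definition _ := isMeasure.Build _ _ _ (@lebesgue_rV n)
  mu0 mu_ge0 mu_sigma_additive.

HB.instance Definition _ := Measure_isSigmaFinite.Build _ _ _ (@lebesgue_rV n)
  mu_sigma_finite.

End instances.

End lebesgue_rV.

Section euclidean.
Variable R : realType.

Definition dotp (N : nat) (u v : 'rV[R]_N) : R := (u *m v^T) 0 0.

(* The library norm on 'rV[R]_N is the sup norm; this is the Euclidean one. *)
Definition enorm (N : nat) (u : 'rV[R]_N) : R := Num.sqrt (dotp u u).

(* The rows of J span the tangent space; kermx J^T is its orthogonal
   complement {w | w *m J^T = 0}. *)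
Definition tan_proj (n N : nat) (J : 'M[R]_(n, N)) (w : 'rV[R]_N) : 'rV[R]_N :=
  w *m proj_mx <<J>>%MS (kermx J^T).

Definition nor_proj (n N : nat) (J : 'M[R]_(n, N)) (w : 'rV[R]_N) : 'rV[R]_N :=
  w *m proj_mx (kermx J^T) <<J>>%MS.

End euclidean.

Section smoothness.
Variables (R : realType) (E W : normedModType R).

Definition iter_derive (vs : seq E) (f : E -> W) : E -> W :=
  foldr (fun v g => fun x => 'D_v g x) f vs.

(* For open U: C^oo, i.e. all iterated directional derivatives exist and are
   Frechet differentiable (hence continuous) on U. *)
Definition smooth_open (U : set E) (f : E -> W) : Prop :=
  forall vs x, U x -> differentiable (iter_derive vs f) x.

(* Smoothness on an arbitrary set, such as U x [0, T[: f is locally the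
   restriction of a smooth function on an open set. *)
Definition smooth_on (A : set E) (f : E -> W) : Prop :=
  forall x, A x -> exists U (g : E -> W),
    [/\ open_nbhs x U, smooth_open U g & {in A `&` U, f =1 g}].

End smoothness.

Section manifolds.
Variables (R : realType) (n : nat).

(* chart_inv is only meaningful on chart_img. *)
Record chart (S : topologicalType) := Chart {
  chart_dom : set S;
  chart_map :> S -> 'rV[R]_n;
  chart_inv : 'rV[R]_n -> S;
  chart_dom_open : open chart_dom;
  chart_img_open : open (chart_map @` chart_dom);
  chart_mapK : forall p, chart_dom p -> chart_inv (chart_map p) = p;
  chart_map_continuous : forall p, chart_dom p -> {for p, continuous chart_map};
  chart_inv_continuous : forall x, (chart_map @` chart_dom) x ->
    {for x, continuous chart_inv}
}.

Definition chart_img (S : topologicalType) (c : chart S) : set 'rV[R]_n :=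
  c @` chart_dom c.

(* The carrier is pointed only because the measure theory of the library
   requires nonempty spaces. The choice chart_at of an atlas chart around each
   point expresses that the atlas covers the manifold. *)
Record smoothManifold := SmoothManifold {
  mf_sort :> ptopologicalType;
  mf_hausdorff : hausdorff_space mf_sort;
  mf_second_countable : @second_countable mf_sort;
  atlas : set (chart mf_sort);
  chart_at : mf_sort -> chart mf_sort;
  chart_at_atlas : forall p, atlas (chart_at p);
  chart_at_dom : forall p, chart_dom (chart_at p) p;
  atlas_compatible : forall c d, atlas c -> atlas d ->
    smooth_on (c @` (chart_dom c `&` chart_dom d)) (d \o chart_inv c)
}.

Definition relatively_compact_domain (S : smoothManifold) (D : set S) : Prop :=
  [/\ open D, connected D & compact (closure D)].

Definition smooth_curve (S : smoothManifold) (gamma : R -> S) : Prop :=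
  continuous gamma /\
  forall c, atlas c -> smooth_on (gamma @^-1` chart_dom c) (c \o gamma).

End manifolds.

Section time.
Variable R : realType.

Definition time_interval (T : \bar R) : set R :=
  [set t | 0 <= t /\ (t%:E < T)%E].

(* f'(t) = l for f defined on [0, T[; the derivative is one-sided at t = 0. *)
Definition has_time_derivative (W : normedModType R) (T : \bar R)
    (f : R -> W) (t : R) (l : W) : Prop :=
  (s - t)^-1 *: (f s - f t) @[s --> within (time_interval T) t^'] --> l.

End time.

Section immersions.
Variables (R : realType) (n N : nat) (S : smoothManifold R n).
Variable F : S -> R -> 'rV[R]_N.

Definition smooth_family (T : \bar R) : Prop :=
  forall c : chart R n S, atlas c ->
    smooth_on [set z : 'rV[R]_n * R | chart_img c z.1 /\ time_interval T z.2]
      (fun z => F (chart_inv c z.1) z.2).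

Variable t : R.

Definition local_repr (c : chart R n S) : 'rV[R]_n -> 'rV[R]_N :=
  fun x => F (chart_inv c x) t.

Definition frame (c : chart R n S) (p : S) : 'M[R]_(n, N) :=
  \matrix_(i < n) 'D_(delta_mx 0 i) (local_repr c) (c p).

Definition immersion : Prop :=
  forall p c, atlas c -> chart_dom c p -> row_free (frame c p).

Definition induced_metric (c : chart R n S) (p : S) : 'M[R]_n :=
  \matrix_(i, j) dotp (row i (frame c p)) (row j (frame c p)).

Definition second_ff (c : chart R n S) (p : S) (i j : 'I_n) : 'rV[R]_N :=
  nor_proj (frame c p)
    ('D_(delta_mx 0 i) (fun x => 'D_(delta_mx 0 j) (local_repr c) x) (c p)).

(* The projections and the mean curvature vector do not depend on the chart
   used to compute them. *)
Definition tangential_part (p : S) : 'rV[R]_N -> 'rV[R]_N :=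
  tan_proj (frame (chart_at p) p).

Definition normal_part (p : S) : 'rV[R]_N -> 'rV[R]_N :=
  nor_proj (frame (chart_at p) p).

Definition mean_curvature (p : S) : 'rV[R]_N :=
  let c := chart_at p in
  \sum_(i < n) \sum_(j < n) invmx (induced_metric c p) i j *: second_ff c p i j.

Definition volume_density (c : chart R n S) (p : S) : R :=
  Num.sqrt (\det (induced_metric c p)).

(* mu is the volume measure of the induced metric: in every chart it is
   sqrt (det g) dx^1 ... dx^n. *)
Definition volume_measure (mu : {measure set (borel S) -> \bar R}) : Prop :=
  forall (c : chart R n S) (B : set (borel S)),
    atlas c -> measurable B -> B `<=` chart_dom c ->
    mu B = (\int[@lebesgue_rV R n]_(x in c @` B)
              (volume_density c (chart_inv c x))%:E)%E.

(* The induced metric gives gamma' the length of (F_t \o gamma)'. *)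
Definition curve_length (gamma : R -> S) : \bar R :=
  (\int[lebesgue_measure]_(s in `[0%R, 1%R])
     (enorm ('D_1 (fun r => F (gamma r) t) s))%:E)%E.

Definition riemannian_distance (p q : S) : \bar R :=
  ereal_inf [set curve_length gamma | gamma in
    [set gamma : R -> S | [/\ smooth_curve gamma, gamma 0 = p & gamma 1 = q]]].

Definition complete_induced_metric : Prop :=
  forall u : nat -> S,
    (forall e : R, 0 < e -> exists K : nat, forall k m : nat,
       (K <= k)%N -> (K <= m)%N -> (riemannian_distance (u k) (u m) < e%:E)%E) ->
    exists p : S, forall e : R, 0 < e -> exists K : nat, forall k : nat,
       (K <= k)%N -> (riemannian_distance (u k) p < e%:E)%E.

End immersions.

Section weighted_volume.
Variables (R : realType) (n N : nat) (S : smoothManifold R n).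
Variables (F : S -> R -> 'rV[R]_N) (V : 'rV[R]_N).

Definition weight (t : R) (p : S) : R := expR (dotp (F p t - t *: V) V).

Definition weighted_volume (mu : R -> {measure set (borel S) -> \bar R})
    (D : set S) (t : R) : R :=
  \int[mu t]_(p in (D : set (borel S))) weight t p.

End weighted_volume.

(* Main.v *)
(** Write W = dF/dt = H + V^T. Then V - W = V^perp - H is normal, so
    <W, F_j> = <V, F_j> in every chart; differentiating this along x_i gives
    <D_i W, F_j> = <V - W, D_i F_j>, whose trace with respect to the metric is
    <V - W, H>. By the symmetry of second derivatives and Jacobi's formula, the
    left-hand trace is the logarithmic derivative of sqrt (det g), while that of
    the weight is <W - V, V>. They add up to - |V - W|^2 = - |H - V^perp|^2.

    The same identity bounds the time derivative of the weighted density locally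
    uniformly, so that dominated convergence applies in a chart; compactness
    reduces the integral over the domain to finitely many charts. *)
Require Import Defs.
From mathcomp Require Import all_boot all_order all_algebra perm.
From mathcomp Require Import all_classical all_reals all_analysis measurable_realfun ring.
Import Order.TTheory GRing.Theory Num.Theory.
Import numFieldNormedType.Exports.
Local Open Scope classical_set_scope.
Local Open Scope ring_scope.
Set Implicit Arguments.
Unset Strict Implicit.
Unset Printing Implicit Defensive.

(** * Derivatives in normed spaces and in time *)

(** [F] is smooth only on [0,T), so at t = 0 its time derivative is one-sided, whereas symmetry of
    second derivatives, Jacobi's formula and the chain rule are applied in two-sided form.
    Computations are therefore made on a smooth extension [g] of the local representation, living on
    an open subset of space-time. The flow equation is known for [g] at admissible times only; this
    suffices because it is differentiated only in space, at a fixed time, where it holds on a whole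
    neighbourhood.

    A second obstacle is that [mean_curvature] is computed in [chart_at p], a chart that may jump
    with p. The pointwise identity is proved in that chart and carried to the others by the Jacobian
    of the transition map; continuity of the decay rate is read off the velocity, not off the
    curvature.

    The measures [mu s] vary with s. In a chart they become densities against one fixed Lebesgue
    measure, and a single constant bounding both the weighted density and its time derivative yields
    integrability and, by the mean value theorem, a bound on the difference quotients. The pieces of
    the domain are Borel rather than open, so that a finite cover can be made disjoint. *)

Lemma nbhs_setI (X : topologicalType) (x : X) (P Q : set X) :
  nbhs x P -> nbhs x Q -> nbhs x (P `&` Q).
Proof. exact: filterI. Qed.

Lemma near_dist_lt (R : realType) (X : topologicalType) (h : X -> R) (z : X) (e : R) :
  {for z, continuous h} -> 0 < e -> nbhs z [set x | `|h z - h x| < e].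
Proof. by move=> /cvgrPdist_lt; apply. Qed.

Lemma near_bounded (R : realType) (X : topologicalType) (h : X -> R) (z : X) :
  {for z, continuous h} -> nbhs z [set x | `|h x| <= `|h z| + 1].
Proof.
move=> hc; apply: filterS (near_dist_lt hc ltr01) => x /= hx.
rewrite -(subKr (h z) (h x)) (le_trans (ler_normB _ _))// lerD2l.
exact: ltW hx.
Qed.

Section directional_derivatives.
Variable R : realType.

(** The two difference quotients are the same function of [h], so mere existence of one directional
    derivative is enough and no Frechet differentiability enters. Instances of [i] are translations,
    lines, and the slices of space-time. *)
Lemma derive_reparam (E E' W : normedModType R) (f : E -> W) (i : E' -> E)
    (a v' : E') (v : E) (l : W) :
  (forall h, i (h *: v' + a) = h *: v + i a) ->
  is_derive (i a) v f l -> is_derive a v' (f \o i) l.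
Proof.
move=> iE [fd <-].
have e : (fun h : R => h^-1 *: (((f \o i) \o shift a) (h *: v') - (f \o i) a)) =
    (fun h => h^-1 *: ((f \o shift (i a)) (h *: v) - f (i a))).
  by apply/funext => h /=; rewrite iE.
by split; rewrite /derivable /derive e.
Qed.

Lemma is_derive_line (E W : normedModType R) (f : E -> W) (x v : E) (a : R) l :
  is_derive (x + a *: v) v f l -> is_derive a 1 (fun b => f (x + b *: v)) l.
Proof.
apply: (@derive_reparam _ R^o _ f (fun b => x + b *: v) a 1 v) => h.
by rewrite scalerDl addrCA; congr (_ *: _ + _); rewrite [LHS]mulr1.
Qed.

Lemma MVT_line (E : normedModType R) (f : E -> R) (x v : E) (h : R) :
  0 < h -> (forall a : R, 0 <= a <= h -> derivable f (x + a *: v) v) ->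
  exists2 c, 0 <= c <= h & f (x + h *: v) - f x = 'D_v f (x + c *: v) * h.
Proof.
move=> h0 df.
have d a : 0 <= a <= h ->
    is_derive a 1 (fun b => f (x + b *: v)) ('D_v f (x + a *: v)).
  by move=> /df/derivableP/is_derive_line.
have [| |c] := @MVT_segment R (fun b => f (x + b *: v))
    (fun a => 'D_v f (x + a *: v)) 0 h (ltW h0).
- by move=> a; rewrite in_itv/= => /andP[a0 ah]; apply: d; rewrite !ltW.
- apply: derivable_within_continuous => a; rewrite in_itv/= => ah.
  by have [] := d _ ah.
by rewrite in_itv/= scale0r addr0 subr0 => ch ->; exists c.
Qed.

(** Two uses of the mean value theorem: along [v] for the increment [p] of [f] in direction [w],
    then along [w] for ['D_v f]. *)
Lemma second_difference (E : normedModType R) (f : E -> R) (z v w : E) (h : R) :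
  0 < h ->
  (forall a b : R, 0 <= a <= h -> 0 <= b <= h ->
    derivable f (z + a *: v + b *: w) v /\
    derivable ('D_v f) (z + a *: v + b *: w) w) ->
  exists a b : R, [/\ 0 <= a <= h, 0 <= b <= h &
    f (z + h *: v + h *: w) - f (z + h *: v) - (f (z + h *: w) - f z) =
    'D_w ('D_v f) (z + a *: v + b *: w) * h * h].
Proof.
move=> h0 df.
have h00 : (0 : R) <= 0 <= h by rewrite lexx ltW.
have hh : 0 <= h <= h by rewrite lexx ltW.
pose p y := f (y + h *: w) - f y.
have dp a : 0 <= a <= h ->
    is_derive (z + a *: v) v p
      ('D_v f (z + a *: v + h *: w) - 'D_v f (z + a *: v)).
  move=> ah; apply: is_deriveB.
    apply: (@derive_reparam _ _ _ f (fun y => y + h *: w) _ v v).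
      by move=> k; rewrite -addrA.
    by have [dv _] := df _ _ ah hh; apply/derivableP; exact: dv.
  have [dv _] := df _ _ ah h00; apply/derivableP.
  by rewrite scale0r addr0 in dv; exact: dv.
have [|a ah pE] := @MVT_line _ p z v h h0.
  by move=> a /dp[].
have [|b bh qE] := @MVT_line _ ('D_v f) (z + a *: v) w h h0.
  by move=> b bh; have [] := df _ _ ah bh.
exists a, b; split => //.
have -> : f (z + h *: v + h *: w) - f (z + h *: v) - (f (z + h *: w) - f z) =
  p (z + h *: v) - p z by [].
by rewrite pE; have [_ ->] := dp _ ah; rewrite qE.
Qed.

Lemma dist_le_close (e x y x' y' : R) :
  `|x - x'| < e / 2 -> `|y - y'| < e / 2 -> x' = y' -> `|x - y| <= e.
Proof.
move=> Hx Hy xy; rewrite (splitr e) -(subrKA x').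
by rewrite (le_trans (ler_normD _ _))// lerD ?ltW// xy distrC.
Qed.

(** The second difference is symmetric in [v] and [w], so the two mixed derivatives agree at some
    pair of points of any small parallelogram at [z]; continuity at [z] does the rest. *)
Lemma derive_swap (E : normedModType R) (f : E -> R) (z v w : E) :
  (\forall x \near z, [/\ derivable f x v, derivable f x w,
     derivable ('D_v f) x w & derivable ('D_w f) x v]) ->
  {for z, continuous ('D_w ('D_v f))} -> {for z, continuous ('D_v ('D_w f))} ->
  'D_w ('D_v f) z = 'D_v ('D_w f) z.
Proof.
move=> df cvw cwv; apply/eqP; rewrite -subr_eq0 -normr_le0; apply/ler_addgt0Pl => e e0.
rewrite addr0; have e20 : 0 < e / 2 by rewrite divr_gt0.
have : \forall x \near z, [/\ [/\ derivable f x v, derivable f x w,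
     derivable ('D_v f) x w & derivable ('D_w f) x v],
     `|'D_w ('D_v f) z - 'D_w ('D_v f) x| < e / 2 &
     `|'D_v ('D_w f) z - 'D_v ('D_w f) x| < e / 2].
  have := nbhs_setI df (nbhs_setI (near_dist_lt cvw e20) (near_dist_lt cwv e20)).
  by apply: filterS => x [H1 [H2 H3]]; split; [exact: H1|exact: H2|exact: H3].
case/nbhs_ballP => r /= r0 rP.
(* The parallelogram of side [h] stays in the ball of radius [r], as [h] times [|v| + |w| + 1] is
   [r / 2]; the [+ 1] keeps the denominator positive when both vectors vanish. *)
pose h := r / (2 * (`|v| + `|w| + 1)).
have vw : 0 < `|v| + `|w| + 1 by rewrite ltr_wpDl ?addr_ge0.
have h0 : 0 < h by rewrite divr_gt0// mulr_gt0.
have inball a b : 0 <= a <= h -> 0 <= b <= h -> ball z r (z + a *: v + b *: w).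
  move=> /andP[a0 ah] /andP[b0 bh].
  rewrite -ball_normE /ball_/= -addrA opprD addNKr normrN.
  rewrite (le_lt_trans (ler_normD _ _))// !normrZ !ger0_norm//.
  rewrite (@le_lt_trans _ _ (h * (`|v| + `|w|)))//.
    by rewrite mulrDr lerD// ler_wpM2r.
  rewrite (@lt_le_trans _ _ (h * (`|v| + `|w| + 1)))//.
    by rewrite ltr_pM2l// ltrDl.
  rewrite /h invfM mulrA mulfVK ?gt_eqF//.
  by rewrite ler_pdivrMr// ler_pMr// ler1n.
have [a [b [ah bh E1]]] : exists a b : R, [/\ 0 <= a <= h, 0 <= b <= h &
    f (z + h *: v + h *: w) - f (z + h *: v) - (f (z + h *: w) - f z) =
    'D_w ('D_v f) (z + a *: v + b *: w) * h * h].
  apply: (second_difference h0) => a b ah bh.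
  have [[H1 _ H2 _] _ _] := rP _ (inball _ _ ah bh).
  by split; [exact: H1|exact: H2].
have [b' [a' [bh' ah' E2]]] : exists a b : R, [/\ 0 <= a <= h, 0 <= b <= h &
    f (z + h *: w + h *: v) - f (z + h *: w) - (f (z + h *: v) - f z) =
    'D_v ('D_w f) (z + a *: w + b *: v) * h * h].
  apply: (second_difference h0) => b' a' bh' ah'.
  have [[_ H1 _ H2] _ _] := rP _ (inball _ _ ah' bh').
  by rewrite addrAC; split; [exact: H1|exact: H2].
rewrite [z + b' *: w + a' *: v]addrAC [z + h *: w + h *: v]addrAC in E2.
have E3 : 'D_w ('D_v f) (z + a *: v + b *: w) =
          'D_v ('D_w f) (z + a' *: v + b' *: w).
  apply: (mulIf (lt0r_neq0 h0)); apply: (mulIf (lt0r_neq0 h0)).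
  apply: etrans (esym E1) _; apply: etrans E2.
  by rewrite !opprB [LHS]addrACA [RHS]addrACA [in RHS](addrC (- _)).
have [_ B1 _] := rP _ (inball _ _ ah bh).
have [_ _ B2] := rP _ (inball _ _ ah' bh').
exact: dist_le_close B1 B2 E3.
Qed.

End directional_derivatives.

(** * One-sided derivatives on the time interval *)

Section time_derivative.
Variables (R : realType) (T : \bar R).
Let I := time_interval T.
Implicit Types (W : normedModType R) (s t : R).

Lemma time_interval_between s s' t : I s -> I s' -> s <= t <= s' -> I t.
Proof.
move=> [s0 _] [_ s'T] /andP[st ts']; split; first exact: le_trans st.
by rewrite (le_lt_trans _ s'T)// lee_fin.
Qed.

Lemma time_interval_right t : I t -> exists2 e, 0 < e & forall s, t <= s < t + e -> I s.
Proof.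
move=> [t0]; rewrite /I /time_interval; case: T => [u||]//=.
- rewrite lte_fin => tu; exists (u - t); first by rewrite subr_gt0.
  move=> s /andP[ts]; rewrite addrC subrK => su.
  by rewrite lte_fin; split => //; exact: le_trans ts.
- move=> _; exists 1 => // s /andP[ts _]; split; first exact: le_trans ts.
  by rewrite ltry.
Qed.

(** The interval is open on the right, so every [t] in it, including 0, is a limit of later
    admissible times. Properness is what makes the time derivative unique. *)
Lemma time_filter_proper t : I t -> ProperFilter (within I t^').
Proof.
move=> It; apply: Build_ProperFilter_ex => P tP.
have {tP} /nbhs_ballP[e/= e0 eP] : nbhs t (fun x => x != t -> I x -> P x) := tP.
have [d d0 dI] := time_interval_right It.
pose r := Num.min e d / 2.
have r0 : 0 < r by rewrite divr_gt0// lt_min e0.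
have rm : r < Num.min e d by rewrite ltr_pdivrMr// ltr_pMr ?ltr1n// lt_min e0.
move: rm; rewrite lt_min => /andP[re rd].
exists (t + r); apply: eP.
- by rewrite -ball_normE /ball_/= opprD addNKr normrN gtr0_norm.
- by rewrite -subr_eq0 addrAC subrr add0r gt_eqF.
- by apply: dI; rewrite lerDl ltW//= ltrD2l.
Qed.

Lemma time_derivative_unique W (f : R -> W) t l1 l2 : I t ->
  has_time_derivative T f t l1 -> has_time_derivative T f t l2 -> l1 = l2.
Proof.
move=> It; have := time_filter_proper It => PF.
exact: (cvg_unique (@norm_hausdorff _ W)).
Qed.

Lemma is_derive_has_time_derivative W (f : R -> W) t l :
  is_derive t 1 f l -> has_time_derivative T f t l.
Proof.
move=> [df dl]; have : h^-1 *: (f (h *: 1 + t) - f t) @[h --> 0^'] --> l.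
  by rewrite -dl; exact: df.
move=> /cvgrPdist_le fl; apply/cvgrPdist_le => e /fl.
rewrite !near_withinE => /nbhs_ballP[d/= d0 dP].
apply/nbhs_ballP; exists d => //= s ts st _.
have := dP (s - t); rewrite /= [_%:A]mulr1 subrK; apply; last by rewrite subr_eq0.
by rewrite -ball_normE /ball_/= sub0r normrN distrC; move: ts; rewrite -ball_normE.
Qed.

(** Agreement is asked at times of [I] only, which is all that is known when [f] comes from [F] and
    [g] from an extension. *)
Lemma near_eq_time_derivative W (f g : R -> W) t l : I t ->
  (\forall s \near t, I s -> f s = g s) ->
  has_time_derivative T g t l -> has_time_derivative T f t l.
Proof.
move=> It fg; apply: cvg_trans; apply: near_eq_cvg.
rewrite !near_withinE; have ft := nbhs_singleton fg It.
by apply: filterS fg => s fg _ Is; rewrite fg// ft.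
Qed.

Lemma time_derivativeD W (f g : R -> W) t l m :
  has_time_derivative T f t l -> has_time_derivative T g t m ->
  has_time_derivative T (fun s => f s + g s) t (l + m).
Proof.
move=> fl gm; rewrite /has_time_derivative.
under eq_fun do rewrite opprD addrACA scalerDr.
exact: cvgD.
Qed.

Lemma time_derivativeZ (a : R) W (f : R -> W) t l :
  has_time_derivative T f t l -> has_time_derivative T (fun s => a *: f s) t (a *: l).
Proof.
move=> fl; rewrite /has_time_derivative.
under eq_fun do rewrite -scalerBr scalerA mulrC -scalerA.
exact: cvgZl_tmp.
Qed.

Lemma time_derivative_interior W (f : R -> W) t l :
  (\forall s \near t, I s) -> has_time_derivative T f t l -> is_derive t 1 f l.
Proof.
move=> It fl.
have {}fl : h^-1 *: ((f \o shift t) (h *: 1) - f t) @[h --> 0^'] --> l.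
  move/cvgrPdist_le : fl => fl; apply/cvgrPdist_le => e /fl.
  rewrite !near_withinE => eP; have {eP} It' := nbhs_setI It eP.
  have [d/= d0 dP] := (nbhs_ballP _ _).1 It'.
  apply/nbhs_ballP; exists d => //= h hd h0.
  have /= := dP (h + t); rewrite [_%:A]mulr1 addrK.
  case; last by move=> Ih; apply => //; rewrite -subr_eq0 addrK.
  move: hd; rewrite -!ball_normE /ball_/= sub0r normrN.
  by rewrite (addrC h) opprD addNKr normrN.
by split; [apply/cvg_ex; exists l|exact: cvg_lim fl].
Qed.

(** Close to [t] the difference quotient is bounded by [K], that is [|l| + 1], hence the increment
    by [K] times [|s - t|]. *)
Lemma time_derivative_continuous W (f : R -> W) t l :
  has_time_derivative T f t l -> f s @[s --> within I (nbhs t)] --> f t.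
Proof.
move=> fl; apply/cvgrPdist_le => e e0.
have := fl => /cvgrPdist_le/(_ 1 ltr01); rewrite !near_withinE.
pose K := `|l| + 1; have K0 : 0 < K by rewrite ltr_wpDl.
move=> fK.
have {fK} :=
  nbhs_setI fK (nbhsx_ballx t _ (divr_gt0 e0 K0)).
apply: filterS => s [fK]; rewrite -ball_normE /ball_/= => tse Is.
have [->|st] := eqVneq s t; first by rewrite subrr normr0 ltW.
have {}fK := fK st Is.
have st0 : s - t != 0 by rewrite subr_eq0.
have dK : `|(s - t)^-1 *: (f s - f t)| <= K.
  rewrite -[X in `|X|](subKr l) (le_trans (ler_normB _ _))// lerD2l.
  exact: fK.
move: dK; rewrite normrZ normfV ler_pdivrMl ?normr_gt0// distrC => /le_trans; apply.
rewrite distrC in tse.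
by rewrite -ler_pdivlMr// ltW.
Qed.

(** The mean value theorem wants two-sided derivatives inside the segment and only continuity at its
    ends, which is what the one-sided derivative supplies when [s] is 0. *)
Lemma time_derivative_lipschitz (f l : R -> R) (M s s' : R) :
  I s -> I s' -> s <= s' ->
  (forall r, s <= r <= s' -> has_time_derivative T f r (l r) /\ `|l r| <= M) ->
  `|f s' - f s| <= M * `|s' - s|.
Proof.
move=> Is Is' ss' df.
have [r rs||c cs ->] := @MVT_segment R f l s s' ss'.
- move: (rs); rewrite in_itv/= => /andP[sr rs'].
  have [fr _] := df r (introT andP (conj (ltW sr) (ltW rs'))).
  apply: time_derivative_interior fr.
  have := near_in_itvoo rs; apply: filterS => u.
  rewrite in_itv/= => /andP[su us'].
  by apply: (time_interval_between Is Is'); rewrite !ltW.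
- apply/subspace_continuousP => r; rewrite /= in_itv/= => rs.
  have [/time_derivative_continuous fr _] := df _ rs.
  apply: cvg_trans fr; apply: cvg_app => P rP.
  have {}rP : nbhs r (fun u => I u -> P u) := rP.
  change (nbhs r (fun u => [set` `[s, s']] u -> P u)).
  apply: filterS rP => u uP; rewrite /= in_itv/= => us; apply: uP.
  exact: (time_interval_between Is Is').
- by rewrite normrM ler_wpM2r//; have [] := df c; rewrite // -in_itv.
Qed.

End time_derivative.

(** * Euclidean projections and Gram determinants *)

Section euclidean_projections.
Variable R : realType.

Lemma dotpE N (u v : 'rV[R]_N) : dotp u v = \sum_i u 0 i * v 0 i.
Proof. by rewrite /dotp mxE; apply: eq_bigr => i _; rewrite mxE. Qed.

Lemma dotpC N (u v : 'rV[R]_N) : dotp u v = dotp v u.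
Proof. by rewrite !dotpE; apply: eq_bigr => i _; rewrite mulrC. Qed.

Lemma dotpDl N (u v w : 'rV[R]_N) : dotp (u + v) w = dotp u w + dotp v w.
Proof. by rewrite /dotp mulmxDl mxE. Qed.

Lemma dotpBl N (u v w : 'rV[R]_N) : dotp (u - v) w = dotp u w - dotp v w.
Proof. by rewrite /dotp mulmxBl !mxE. Qed.

Lemma dotpBr N (u v w : 'rV[R]_N) : dotp u (v - w) = dotp u v - dotp u w.
Proof. by rewrite ![dotp u _]dotpC dotpBl. Qed.

Lemma dotpZr N (a : R) (u v : 'rV[R]_N) : dotp u (a *: v) = a * dotp u v.
Proof. by rewrite /dotp linearZ /= -scalemxAr mxE. Qed.

Lemma dotpNl N (u v : 'rV[R]_N) : dotp (- u) v = - dotp u v.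
Proof. by rewrite /dotp mulNmx mxE. Qed.

Lemma dotp_sumr N (I : finType) (u : 'rV[R]_N) (v : I -> 'rV[R]_N) :
  dotp u (\sum_i v i) = \sum_i dotp u (v i).
Proof. by rewrite /dotp linear_sum mulmx_sumr summxE. Qed.

Lemma dotp_ge0 N (u : 'rV[R]_N) : 0 <= dotp u u.
Proof. by rewrite dotpE sumr_ge0// => i _; rewrite -expr2 sqr_ge0. Qed.

Lemma dotp_eq0 N (u : 'rV[R]_N) : dotp u u = 0 -> u = 0.
Proof.
rewrite dotpE => /psumr_eq0P u0; apply/rowP => i; rewrite mxE.
by apply/eqP; rewrite -sqrf_eq0 expr2 u0// => j _; rewrite -expr2 sqr_ge0.
Qed.

Lemma enorm_sqr N (u : 'rV[R]_N) : enorm u ^+ 2 = dotp u u.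
Proof. by rewrite sqr_sqrtr// dotp_ge0. Qed.

Lemma dotp_row n N (z : 'rV[R]_N) (J : 'M[R]_(n, N)) j :
  dotp z (row j J) = (z *m J^T) 0 j.
Proof. by rewrite dotpE mxE; apply: eq_bigr => i _; rewrite !mxE. Qed.

Section projections.
Variables (n N : nat) (J : 'M[R]_(n, N)).

Lemma cap_tangent_normal : (<<J>> :&: kermx J^T)%MS = 0.
Proof.
apply/eqP/rowV0P => v; rewrite sub_capmx genmxE => /andP[/submxP[x vE] /sub_kermxP vJ].
by apply: dotp_eq0; rewrite /dotp {2}vE trmx_mul mulmxA vJ mul0mx mxE.
Qed.

Lemma tan_nor_proj w : tan_proj J w + nor_proj J w = w.
Proof.
apply: add_proj_mx; first exact: cap_tangent_normal.
apply: submx_full; rewrite /row_full mxrank_disjoint_sum ?cap_tangent_normal//.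
by rewrite mxrank_ker genmxE mxrank_tr subnKC// rank_leq_col.
Qed.

Lemma nor_proj_normal w : nor_proj J w *m J^T = 0.
Proof. by apply/sub_kermxP/proj_mx_sub. Qed.

(** The tangential part of [w] is a combination of the rows of [J], to which [z] is orthogonal. This
    trades the second fundamental form for plain second derivatives. *)
Lemma dotp_nor_proj z w : z *m J^T = 0 -> dotp z (nor_proj J w) = dotp z w.
Proof.
move=> zJ; rewrite -[in RHS](tan_nor_proj w) dotpC [in RHS]dotpC dotpDl.
have /submxP[x ->] : (tan_proj J w <= J)%MS.
  by rewrite -(genmxE J) proj_mx_sub.
suff -> : dotp (x *m J) z = 0 by rewrite add0r.
by rewrite dotpC /dotp trmx_mul mulmxA zJ mul0mx mxE.
Qed.

End projections.

Lemma cvg_dotp (X : Type) (G : set_system X) {FF : Filter G} (N : nat)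
    (f h : X -> 'rV[R]_N) (a b : 'rV[R]_N) :
  f x @[x --> G] --> a -> h x @[x --> G] --> b ->
  dotp (f x) (h x) @[x --> G] --> dotp a b.
Proof.
move=> fa hb; rewrite dotpE; under eq_fun do rewrite dotpE.
have coord (u : X -> 'rV[R]_N) (l : 'rV[R]_N) i :
    u x @[x --> G] --> l -> u x 0 i @[x --> G] --> l 0 i.
  move=> ul; apply: (cvg_comp u (fun M : 'rV[R]_N => M 0 i) ul).
  exact: coord_continuous.
apply: cvg_big => [|i _]; first exact: add_continuous.
by apply: cvgM; exact: coord.
Qed.

Lemma cvg_det (X : Type) (F : set_system X) {FF : Filter F} n
    (A : X -> 'M[R]_n) (B : 'M[R]_n) :
  (forall i j, A x i j @[x --> F] --> B i j) -> \det (A x) @[x --> F] --> \det B.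
Proof.
move=> AB; apply: cvg_big => [|s _]; first exact: add_continuous.
apply: cvgMl_tmp; apply: cvg_big => [|i _]; first exact: mul_continuous.
exact: AB.
Qed.

(* The determinant keeps its sign along the segment from the identity to the
   Gram matrix, because every matrix of that segment is positive definite. *)
Lemma gram_det_gt0 n N (J : 'M[R]_(n, N)) : row_free J -> 0 < \det (J *m J^T).
Proof.
move=> Jf; pose G s : 'M[R]_n := s *: (J *m J^T) + (1 - s)%:M.
have Gdet s : 0 <= s <= 1 -> \det (G s) != 0.
  move=> /andP[s0 s1]; rewrite -unitfE -unitmxE -row_free_unit -kermx_eq0.
  apply/rowV0P => v /sub_kermxP vG.
  have : s * dotp (v *m J) (v *m J) + (1 - s) * dotp v v = 0.
    have : ((v *m G s) *m v^T) 0 0 = 0 by rewrite vG mul0mx mxE.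
    rewrite /G mulmxDr mulmxDl mxE -scalemxAr -scalemxAl mul_mx_scalar -scalemxAl.
    by rewrite /dotp trmx_mul !mulmxA !mxE.
  move=> /eqP; rewrite paddr_eq0 ?mulr_ge0 ?dotp_ge0 ?subr_ge0// !mulf_eq0.
  have [->|s1'] := eqVneq s 1.
    rewrite oner_eq0 subrr eqxx/= andbT => /eqP/dotp_eq0 vJ.
    by apply/eqP; rewrite -(mulmx_free_eq0 _ Jf) vJ.
  by rewrite subr_eq0 [1 == s]eq_sym (negbTE s1')/= => /andP[_ /eqP/dotp_eq0].
have Gc : {within `[0, 1], continuous (fun s => \det (G s))}.
  apply: continuous_subspaceT => s; apply: cvg_det => i j.
  rewrite /G; under eq_fun do rewrite !mxE.
  rewrite !mxE; apply: cvgD; first by apply: cvgMr_tmp; exact: cvg_id.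
  by apply: cvgMn; apply: cvgB; [exact: cvg_cst|exact: cvg_id].
have -> : J *m J^T = G 1 by rewrite /G scale1r subrr raddf0 addr0.
rewrite ltNge; apply/negP => G1.
have G0 : \det (G 0) = 1 by rewrite /G scale0r add0r subr0 det1.
have [|s s01 /eqP] := @IVT R (fun s => \det (G s)) 0 1 0 ler01 Gc.
  by rewrite G0 min_r ?max_l ?ler01 ?G1// (le_trans G1).
by apply/negP; apply: Gdet; rewrite in_itv in s01.
Qed.

Lemma gram_unit n N (J : 'M[R]_(n, N)) : row_free J -> J *m J^T \in unitmx.
Proof. by move=> /gram_det_gt0 Jf; rewrite unitmxE unitfE gt_eqF. Qed.

Lemma is_derive_congr (E W : normedModType R) (f g : E -> W) (x v : E) (l m : W) :
  is_derive x v f l -> f =1 g -> l = m -> is_derive x v g m.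
Proof. by move=> fl /funext <- <-. Qed.

Lemma is_derive_bigsum (E W : normedModType R) (I : Type) (r : seq I)
    (f : I -> E -> W) (df : I -> W) x v :
  (forall i, is_derive x v (f i) (df i)) ->
  is_derive x v (fun y => \sum_(i <- r) f i y) (\sum_(i <- r) df i).
Proof.
move=> h; elim: r => [|i r IH].
  by under eq_fun do rewrite big_nil; rewrite big_nil; exact: is_derive_cst.
apply: (is_derive_congr (is_deriveD (h i) IH)) => [y|]; by rewrite big_cons.
Qed.

Lemma is_derive_prod n (f : 'I_n -> R -> R) (df : 'I_n -> R) (t : R) :
  (forall i, is_derive t 1 (f i) (df i)) ->
  is_derive t 1 (fun s => \prod_i f i s)
    (\sum_k \prod_i (if i == k then df i else f i t)).
Proof.
elim: n f df => [|n IH] f df h.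
  under eq_fun do rewrite big_ord0.
  by rewrite big_ord0; exact: is_derive_cst.
apply: (is_derive_congr (is_deriveM (h 0) (IH _ _ (fun i => h (lift 0 i))))) => [s|].
  by rewrite big_ord_recl.
rewrite big_ord_recl addrC; congr (_ + _).
  by rewrite big_ord_recl eqxx [LHS]mulrC; congr (_ * _).
rewrite scaler_sumr; apply: eq_bigr => k _.
by rewrite big_ord_recl/=; congr (_ * _); apply: eq_bigr => i _.
Qed.

(** Jacobi's formula. In the derivative of the Leibniz expansion, the terms in which the factor from
    row [k] is differentiated add up to the determinant of [B k], the matrix [A t] with row [k]
    replaced by that of [dA]; it is expanded along this row. *)
Lemma is_derive_det n (A : R -> 'M[R]_n) (dA : 'M[R]_n) (t : R) :
  (forall i j, is_derive t 1 (fun s => A s i j) (dA i j)) ->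
  is_derive t 1 (fun s => \det (A s)) (\sum_i \sum_j dA i j * cofactor (A t) i j).
Proof.
move=> h.
pose B k : 'M[R]_n := \matrix_(i, j) if i == k then dA i j else A t i j.
have : is_derive t 1 (fun s => \det (A s)) (\sum_(s : 'S_n) (-1) ^+ s *
    \sum_k \prod_i B k i (s i)).
  apply: is_derive_bigsum => s.
  have D := is_deriveZ ((-1) ^+ s) (is_derive_prod (fun i => h i (s i))).
  apply: (is_derive_congr D) => //.
  rewrite [LHS]/(_ * _); congr (_ * _).
  by apply: eq_bigr => k _; apply: eq_bigr => i _; rewrite mxE.
move=> D; apply: (is_derive_congr D) => //.
under eq_bigr do rewrite mulr_sumr.
rewrite exchange_big; apply: eq_bigr => k _.
rewrite -[LHS]/(\det (B k)) (expand_det_row _ k); apply: eq_bigr => j _.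
rewrite mxE eqxx; congr (_ * (_ * \det _)); apply/matrixP => i i'.
by rewrite !mxE eq_sym (negbTE (neq_lift _ _)).
Qed.

(** A symmetric [G] has symmetric cofactors, equal to [\det G] times the entries of the inverse, so
    both halves of the derivative of the metric contribute alike. The factor 2 cancels against the
    derivative of the square root. *)
Lemma trace_cofactor n (G : 'M[R]_n) (a : 'I_n -> 'I_n -> R) : G^T = G -> G \in unitmx ->
  \sum_i \sum_j (a i j + a j i) * cofactor G i j =
  2 * \det G * \sum_i \sum_j invmx G i j * a i j.
Proof.
move=> Gs Gu.
have cE i j : cofactor G i j = \det G * invmx G i j.
  rewrite /invmx Gu !mxE mulrA divff ?mul1r; last by rewrite -unitfE -unitmxE.
  by rewrite -cofactor_tr Gs.
have cS i j : cofactor G i j = cofactor G j i by rewrite -cofactor_tr Gs.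
under eq_bigr do under eq_bigr do rewrite mulrDl.
under eq_bigr do rewrite big_split.
rewrite big_split/= [X in _ + X]exchange_big/= -mulrA mulrDl mul1r.
have e : \sum_i \sum_j a i j * cofactor G i j =
    \det G * \sum_i \sum_j invmx G i j * a i j.
  rewrite mulr_sumr; apply: eq_bigr => i _; rewrite mulr_sumr; apply: eq_bigr => j _.
  by rewrite cE mulrC mulrA.
rewrite -e; congr (_ + _); apply: eq_bigr => i _; apply: eq_bigr => j _.
by rewrite cS.
Qed.

Lemma sqrt_derivative_rescale (d X : R) : 0 < d ->
  (2 * Num.sqrt d)^-1 * (2 * d * X) = Num.sqrt d * X.
Proof.
move=> d0; have sd : Num.sqrt d != 0 by rewrite gt_eqF// sqrtr_gt0.
rewrite -{2}(sqr_sqrtr (ltW d0)) mulrA; congr (_ * _).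
by rewrite expr2 invfM mulrACA mulVf ?pnatr_eq0// mul1r mulKf.
Qed.

End euclidean_projections.

Section row_vector_derivatives.
Variables (R : realType) (E : normedModType R) (N : nat).
Implicit Types (f g : E -> 'rV[R]_N) (x v : E).

Lemma is_derive_coord f x v df j :
  is_derive x v f df -> is_derive x v (fun y => f y 0 j) (df 0 j).
Proof.
move=> [fd <-]; split; first by move/derivable_mxP : fd.
by rewrite derive_mx// mxE.
Qed.

Lemma is_derive_dotp f g x v df dg :
  is_derive x v f df -> is_derive x v g dg ->
  is_derive x v (fun y => dotp (f y) (g y)) (dotp df (g x) + dotp (f x) dg).
Proof.
move=> fd gd; have h i := is_deriveM (is_derive_coord i fd) (is_derive_coord i gd).
apply: (is_derive_congr (is_derive_bigsum _ h)) => [y|]; first by rewrite dotpE.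
rewrite !dotpE -big_split; apply: eq_bigr => i _ /=.
by rewrite addrC /GRing.scale/= [g x 0 i * _]mulrC.
Qed.

Lemma differentiable_row_coord f x j :
  differentiable f x -> differentiable (fun y => f y 0 j) x.
Proof.
move=> fd; apply: (@differentiable_comp _ _ _ _ f (fun M : 'rV[R]_N => M 0 j)) => //.
exact: differentiable_coord.
Qed.

(** The scalar statement is applied to each coordinate. Coordinates of derivatives must be
    identified with derivatives of coordinates on a neighbourhood, not just at [z], since they are
    differentiated again. *)
Lemma smooth_derive_swap (U : set E) f z v w : open U -> smooth_open U f -> U z ->
  'D_w ('D_v f) z = 'D_v ('D_w f) z.
Proof.
move=> oU fU Uz.
have nU x : U x -> \forall x \near x, U x by move=> Ux; exact: open_nbhs_nbhs.
have d1 x u : U x -> differentiable ('D_u f) x by exact: (fU [:: u]).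
have d2 x u u' : U x -> differentiable ('D_u ('D_u' f)) x by exact: (fU [:: u; u']).
have d0 x : U x -> differentiable f x by exact: (fU [::]).
have e1 x u j : U x -> 'D_u f x 0 j = 'D_u (fun y => f y 0 j) x.
  by move=> Ux; rewrite derive_mx; [rewrite mxE|apply/diff_derivable/d0].
have e1' x u j : U x ->
    \forall y \near x, 'D_u f y 0 j = 'D_u (fun y => f y 0 j) y.
  by move=> /nU; apply: filterS => y Uy; exact: e1.
have e2 x u u' j : U x ->
    'D_u ('D_u' f) x 0 j = 'D_u ('D_u' (fun y => f y 0 j)) x.
  move=> Ux; rewrite derive_mx; last exact/diff_derivable/d1.
  by rewrite mxE; apply/near_eq_derive/e1'.
have D1 x u u' j : U x -> derivable ('D_u (fun y => f y 0 j)) x u'.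
  move=> Ux; apply: near_eq_derivable (e1' x u j Ux) _.
  by apply/diff_derivable/differentiable_row_coord/d1.
have C2 u u' j : {for z, continuous ('D_u ('D_u' (fun y => f y 0 j)))}.
  apply: (@cvg_trans _ (('D_u ('D_u' f) x 0 j) @[x --> z])).
    by apply: near_eq_cvg; apply: filterS (nU _ Uz) => x Ux; exact: e2.
  rewrite -e2//.
  apply: (@differentiable_continuous _ _ _ _ (fun x => 'D_u ('D_u' f) x 0 j)).
  exact/differentiable_row_coord/d2.
have D0 x u j : U x -> derivable (fun y => f y 0 j) x u.
  by move=> Ux; exact/diff_derivable/differentiable_row_coord/d0.
apply/rowP => j.
refine (etrans (e2 z w v j Uz) (etrans _ (esym (e2 z v w j Uz)))).
apply: derive_swap; [|exact: C2|exact: C2].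
apply: filterS (nU _ Uz) => x Ux.
split; [exact: D0|exact: D0|exact: D1|exact: D1].
Qed.

End row_vector_derivatives.

(** * Charts and smooth extensions in space-time *)

Section charts.
Variables (R : realType) (n : nat) (S : smoothManifold R n).
Implicit Types (c d : chart R n S) (q : S) (x : 'rV[R]_n).

Lemma chart_imgP c x : chart_img c x ->
  chart_dom c (chart_inv c x) /\ c (chart_inv c x) = x.
Proof. by move=> [q cq <-]; rewrite chart_mapK. Qed.

Lemma chart_map_img c q : chart_dom c q -> chart_img c (c q).
Proof. by exists q. Qed.

Lemma near_chart_inv c x (P : set S) : chart_img c x ->
  nbhs (chart_inv c x) P -> \forall y \near x, chart_img c y /\ P (chart_inv c y).
Proof.
move=> cx nP; have oc := open_nbhs_nbhs (conj (chart_img_open (c := c)) cx).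
have cc := chart_inv_continuous cx.
exact: nbhs_setI oc (cc _ nP).
Qed.

Lemma near_chart_dom c q : chart_dom c q -> nbhs q (chart_dom c).
Proof. by move=> cq; apply: open_nbhs_nbhs; split => //; exact: chart_dom_open. Qed.

(** Compatibility only provides a smooth function agreeing with the transition map on the image of
    the overlap; that image is a neighbourhood of [c q], so the two have the same derivatives
    there. *)
Lemma transition_map c d q : atlas c -> atlas d -> chart_dom c q -> chart_dom d q ->
  exists2 h : 'rV[R]_n -> 'rV[R]_n, differentiable h (c q) &
    \forall y \near c q, chart_dom d (chart_inv c y) /\ h y = d (chart_inv c y).
Proof.
move=> ac ad cq dq.
have [|U [h [[oU Uq] hU eqh]]] := atlas_compatible ac ad (x := c q); first by exists q.
exists h; first exact: (hU [::]).
have nA : nbhs (c q) [set y | chart_img c y /\ chart_dom d (chart_inv c y)].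
  apply: near_chart_inv; first exact: chart_map_img.
  by rewrite chart_mapK//; exact: near_chart_dom.
have nU := open_nbhs_nbhs (conj oU Uq).
apply: filterS (nbhs_setI nA nU) => y [[cy dy] Uy]; split => //.
have [cy' cyE] := chart_imgP cy.
by rewrite -eqh// inE; split => //; exists (chart_inv c y).
Qed.

End charts.

Lemma differentiable_pairl (R : realType) (E W : normedModType R) (x : E) (s : W) :
  differentiable (fun y => (y, s)) x.
Proof.
by apply: differentiable_pair; [exact: ex_diff|exact: differentiable_cst].
Qed.

Lemma differentiable_pairr (R : realType) (E W : normedModType R) (x : E) (s : W) :
  differentiable (fun r => (x, r)) s.
Proof.
by apply: differentiable_pair; [exact: differentiable_cst|exact: ex_diff].
Qed.

Section local_extensions.
Variables (R : realType) (n N : nat) (S : smoothManifold R n) (T : \bar R).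
Variable F : S -> R -> 'rV[R]_N.
Let I := time_interval T.
Let e_ (i : 'I_n) : 'rV[R]_n := delta_mx 0 i.

(* Since g is smooth on a full neighbourhood, its time derivative at t = 0 is
   two-sided, whereas the one of F is one-sided there. *)
Definition local_extension (c : chart R n S) (U : set ('rV[R]_n * R))
    (g : 'rV[R]_n * R -> 'rV[R]_N) : Prop :=
  [/\ open U, smooth_open U g & forall z, U z ->
    chart_img c z.1 /\ (I z.2 -> F (chart_inv c z.1) z.2 = g z)].

Lemma exists_local_extension c q s : smooth_family F T -> atlas c ->
  chart_dom c q -> I s -> exists U g, local_extension c U g /\ U (c q, s).
Proof.
move=> hF ac cq Is.
have [|U [g [[oU Uq] gU eqg]]] := hF c ac (c q, s); first by split=> //; exists q.
exists (U `&` [set z | chart_img c z.1]), g; split; last by split => //; exists q.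
split.
- apply: openI => //.
  by apply: open_comp (@chart_img_open _ _ _ c) => z _; exact: cvg_fst.
- by move=> vs z [Uz _]; exact: gU.
- by move=> z [Uz cz]; split => // Iz; apply: eqg; rewrite inE.
Qed.

Section fixed.
Variables (c : chart R n S) (U : set ('rV[R]_n * R)) (g : 'rV[R]_n * R -> 'rV[R]_N).
Hypothesis gext : local_extension c U g.
Let oU : open U. Proof. by have [] := gext. Qed.
Let gU : smooth_open U g. Proof. by have [] := gext. Qed.

Lemma near_slice x s : U (x, s) -> \forall y \near x, U (y, s).
Proof.
move=> Uxs; have nU := open_nbhs_nbhs (conj oU Uxs).
have cs : {for x, continuous (fun y => (y, s))}.
  exact/differentiable_continuous/differentiable_pairl.
exact: (cs U nU).
Qed.

Lemma near_time_slice x s : U (x, s) -> \forall r \near s, U (x, r).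
Proof.
move=> Uxs; have nU := open_nbhs_nbhs (conj oU Uxs).
have cs : {for s, continuous (fun r => (x, r))}.
  exact/differentiable_continuous/differentiable_pairr.
exact: (cs U nU).
Qed.

Lemma ext_local_repr x s : U (x, s) -> I s -> local_repr F s c x = g (x, s).
Proof. by move=> Uxs Is; have [_ _ /(_ _ Uxs)[_ /(_ Is)]] := gext. Qed.

Lemma near_ext_local_repr x s : U (x, s) -> I s ->
  \forall y \near x, local_repr F s c y = g (y, s).
Proof.
by move=> /near_slice + Is; apply: filterS => y Uys; exact: ext_local_repr.
Qed.

Lemma is_derive_space (W : normedModType R) (f : 'rV[R]_n * R -> W) x s v :
  differentiable f (x, s) ->
  is_derive x v (fun y => f (y, s)) ('D_(v, 0) f (x, s)).
Proof.
move=> fd; apply: (@derive_reparam _ _ _ _ f (fun y => (y, s)) x v (v, 0)).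
  by move=> h; congr (_, _); rewrite /= scaler0 add0r.
exact/derivableP/diff_derivable.
Qed.

Lemma is_derive_in_time (W : normedModType R) (f : 'rV[R]_n * R -> W) x s :
  differentiable f (x, s) ->
  is_derive s 1 (fun r => f (x, r)) ('D_(0, 1) f (x, s)).
Proof.
move=> fd; apply: (@derive_reparam _ _ _ _ f (fun r => (x, r)) s 1 (0, 1)).
  by move=> h; congr (_, _); rewrite /= scaler0 add0r.
exact/derivableP/diff_derivable.
Qed.

Lemma ext_derive x s v : U (x, s) -> I s ->
  'D_v (local_repr F s c) x = 'D_(v, 0) g (x, s).
Proof.
move=> Uxs Is; rewrite (near_eq_derive _ (near_ext_local_repr Uxs Is)).
by have [] := is_derive_space v (gU [::] Uxs).
Qed.

Lemma ext_derive2 x s v w : U (x, s) -> I s ->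
  'D_v (fun y => 'D_w (local_repr F s c) y) x = 'D_(v, 0) ('D_(w, 0) g) (x, s).
Proof.
move=> Uxs Is.
have e : \forall y \near x, 'D_w (local_repr F s c) y = 'D_(w, 0) g (y, s).
  by apply: filterS (near_slice Uxs) => y Uys; exact: ext_derive.
rewrite (near_eq_derive _ e).
by have [] := is_derive_space v (gU [:: (w, 0)] Uxs).
Qed.

Lemma ext_frame q s : chart_dom c q -> U (c q, s) -> I s ->
  frame F s c q = \matrix_(i < n) 'D_(e_ i, 0) g (c q, s).
Proof. by move=> cq Uqs Is; apply/row_matrixP => i; rewrite !rowK ext_derive. Qed.

Lemma ext_time_derivative q s : chart_dom c q -> U (c q, s) -> I s ->
  has_time_derivative T (F q) s ('D_(0, 1) g (c q, s)).
Proof.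
move=> cq Uqs Is.
apply: (near_eq_time_derivative Is); last first.
  exact: is_derive_has_time_derivative (is_derive_in_time (gU [::] Uqs)).
apply: filterS (near_time_slice Uqs) => r Uqr Ir.
by rewrite /= -ext_local_repr// /local_repr chart_mapK.
Qed.

End fixed.

(** [K] is the Jacobian matrix of the transition map at [q]. It comes before [s] in the statement
    because one matrix serves all times; the ratio of the two densities is thus constant in time. *)
Lemma frame_change c d q : smooth_family F T -> atlas c -> atlas d ->
  chart_dom c q -> chart_dom d q ->
  exists K : 'M[R]_n, forall s, I s -> frame F s c q = K *m frame F s d q.
Proof.
move=> hF ac ad cq dq; have [h hd hE] := transition_map ac ad cq dq.
have hq : h (c q) = d q by have [_] := nbhs_singleton hE; rewrite chart_mapK.
exists (\matrix_i 'D_(e_ i) h (c q)) => s Is.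
have [U [g [gext Uq]]] := exists_local_extension hF ad dq Is.
have [_ gU _] := gext.
pose f y := g (y, s).
have fd : differentiable f (d q).
  apply: (@differentiable_comp _ _ _ _ (fun y => (y, s)) g); last exact: (gU [::]).
  exact: differentiable_pairl.
have near_f : \forall y \near c q, local_repr F s c y = (f \o h) y.
  have hc : {for c q, continuous h} by exact: differentiable_continuous.
  have := near_ext_local_repr gext Uq Is; rewrite -hq => /hc hn.
  apply: filterS (nbhs_setI hE hn) => y [[dy hy]]; rewrite /f /= hy => <-.
  by rewrite /local_repr chart_mapK.
apply/row_matrixP => i; rewrite rowK row_mul rowK.
rewrite (near_eq_derive _ near_f) deriveE; last first.
  by apply: differentiable_comp; rewrite ?hq.
rewrite diff_comp ?hq//= [in RHS]deriveE//.
set u := 'd h (c q) _; rewrite [u in LHS](row_sum_delta u) linear_sum.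
rewrite mulmx_sum_row; apply: eq_bigr => k _.
rewrite linearZ; congr (_ *: _).
rewrite rowK (ext_derive gext (e_ k) Uq Is).
have [_ <-] := is_derive_space (e_ k) (gU [::] _ Uq).
exact: esym (deriveE (e_ k) fd).
Qed.

End local_extensions.

(** * Integration *)

Lemma integrable_setU d (X : measurableType d) (R : realType)
    (nu : {measure set X -> \bar R}) (A B : set X) (f : X -> R) :
  measurable A -> measurable B -> A `&` B = set0 ->
  nu.-integrable A (EFin \o f) -> nu.-integrable B (EFin \o f) ->
  nu.-integrable (A `|` B) (EFin \o f).
Proof.
move=> mA mB AB /integrableP[mfA iA] /integrableP[mfB iB].
have mU : measurable_fun (A `|` B) (EFin \o f) by apply/measurable_funU.
apply/integrableP; split=> //.
rewrite ge0_integral_setU//; first exact: lte_add_pinfty.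
- exact: measurableT_comp.
- exact/disj_set2P.
Qed.

Lemma integrable_ge0_transfer d1 d2 (X : measurableType d1) (Y : measurableType d2)
    (R : realType) (nu : {measure set X -> \bar R})
    (lam : {measure set Y -> \bar R}) (A : set X) (E : set Y) (f : X -> R) (h : Y -> R) :
  measurable_fun A f -> (forall x, A x -> 0 <= f x) -> (forall y, E y -> 0 <= h y) ->
  (\int[nu]_(x in A) (f x)%:E = \int[lam]_(y in E) (h y)%:E)%E ->
  lam.-integrable E (EFin \o h) -> nu.-integrable A (EFin \o f).
Proof.
move=> mf f0 h0 fh /integrableP[_ ih]; apply/integrableP; split.
  exact/measurable_EFinP.
rewrite (eq_integral (fun x => (f x)%:E)) ?fh; last first.
  by move=> x /set_mem Ax; rewrite /= ger0_norm ?f0.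
apply: le_lt_trans ih; rewrite le_eqVlt; apply/orP; left; apply/eqP.
by apply: eq_integral => y /set_mem Ey; rewrite /= ger0_norm ?h0.
Qed.

Section density_transfer.
Local Open Scope ereal_scope.
Import HBNNSimple.
Context d1 d2 (X : measurableType d1) (Y : measurableType d2) (R : realType).
Variables (mu : {measure set X -> \bar R}) (nu : {measure set Y -> \bar R}).
Variables (B : set X) (E : set Y) (phi : Y -> X) (rho : Y -> R).
Hypotheses (mB : measurable B) (mE : measurable E).
Hypotheses (mphi : measurable_fun E phi) (mrho : measurable_fun E rho).
Hypotheses (phiE : E `<=` phi @^-1` B) (rho0 : forall y, E y -> (0 <= rho y)%R).
Hypothesis muE : forall A, measurable A -> A `<=` B ->
  mu A = \int[nu]_(y in E `&` phi @^-1` A) (rho y)%:E.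

Let transfer_indic (A : set X) : measurable A ->
  mu (A `&` B) = \int[nu]_(y in E) (\1_A (phi y) * rho y)%:E.
Proof.
move=> mA; rewrite muE; [|exact: measurableI|exact: subIsetr].
rewrite integral_mkcondr; apply: eq_integral => y /set_mem Ey.
rewrite /patch indicE; have [phiA|phiA] := boolP (phi y \in A).
  by rewrite ifT ?mul1r// inE; split; [exact: set_mem|exact: phiE].
rewrite ifF ?mul0r//; apply/negbTE; apply: contra phiA.
by rewrite !inE => -[].
Qed.

Let transfer_nnsfun (h : {nnsfun X >-> R}) :
  \int[mu]_(x in B) (h x)%:E = \int[nu]_(y in E) (h (phi y) * rho y)%:E.
Proof.
have mh k : measurable (h @^-1` [set k]) by exact: measurable_funPTI.
pose F (k : R) (y : Y) : \bar R := (k * \1_(h @^-1` [set k]) (phi y) * rho y)%:E.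
have mfun k : measurable_fun E (F k).
  apply/measurable_EFinP; apply: measurable_funM => //; apply: measurable_funM => //.
  exact: measurableT_comp.
have fun0 k y : E y -> 0 <= F k y.
  by move=> Ey; rewrite /F EFinM; apply: mule_ge0; rewrite ?lee_fin ?rho0//;
    rewrite -lee_fin EFinM; exact: nnfun_muleindic_ge0.
transitivity (\sum_(k \in range h)
    \int[nu]_(y in E) F k y).
  under eq_integral do rewrite fimfunE -fsumEFin//.
  rewrite ge0_integral_fsum//; last 2 first.
  - by move=> y; exact/measurable_EFinP/measurable_funM.
  - by move=> y x _; rewrite nnfun_muleindic_ge0.
  apply: eq_fsbigr => k; rewrite inE => -[x _ hx].
  rewrite integralZl_indic_nnsfun// integral_indic// transfer_indic//.
  rewrite -ge0_integralZl_EFin//.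
  - by apply: eq_integral => y _; rewrite -EFinM mulrA.
  - by move=> y Ey; rewrite lee_fin mulr_ge0 ?rho0.
  - by apply/measurable_EFinP; apply: measurable_funM => //; exact: measurableT_comp.
  - by rewrite -hx.
rewrite -ge0_integral_fsum//; apply: eq_integral => y _.
by rewrite fsumEFin// [in RHS]fimfunE !fsbig_finite// mulr_suml.
Qed.

(** The hypothesis on [mu] is the case of indicators; simple functions follow by linearity over
    their finite range, and [f] by monotone convergence on both sides. *)
Lemma ge0_integral_density_transfer (f : X -> R) :
  measurable_fun B f -> (forall x, B x -> (0 <= f x)%R) ->
  \int[mu]_(x in B) (f x)%:E = \int[nu]_(y in E) (f (phi y) * rho y)%:E.
Proof.
move=> /measurable_EFinP mf f0.
pose f_ := nnsfun_approx mB mf.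
have cf_ x : B x -> (f_ k x)%:E @[k --> \oo] --> (f x)%:E.
  by move=> Bx; apply: cvg_nnsfun_approx => // y By; rewrite lee_fin f0.
transitivity (limn (fun k => \int[mu]_(x in B) (f_ k x)%:E)).
  rewrite -monotone_convergence//.
  - by apply: eq_integral => x /[!inE] Bx; apply/esym/cvg_lim => //; exact: cf_.
  - by move=> k; exact/measurable_EFinP/measurable_funP.
  - by move=> k x _; rewrite lee_fin.
  - by move=> x _ k m km; rewrite lee_fin; exact/lefP/nd_nnsfun_approx.
under eq_fun do rewrite transfer_nnsfun.
rewrite -monotone_convergence//.
- apply: eq_integral => y /[!inE] Ey; apply/cvg_lim => //.
  under eq_fun do rewrite EFinM.
  by rewrite EFinM; apply: cvgeZr => //; apply: cf_; exact: phiE.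
- move=> k; apply/measurable_EFinP; apply: measurable_funM => //.
  by apply: measurableT_comp => //; exact: measurable_funP.
- by move=> k y Ey; rewrite lee_fin mulr_ge0 ?rho0.
- move=> y Ey k m km; rewrite lee_fin ler_wpM2r ?rho0//.
  exact/lefP/nd_nnsfun_approx.
Qed.

End density_transfer.

(** * Differentiation under the integral sign *)

Section dominated_time_derivative.
Variables (R : realType) (T : \bar R).
Let I := time_interval T.

(** Reduces the limit to sequences, the form in which dominated convergence applies. Only times
    within [d] of [t] are tested, since the estimates hold only there. *)
Lemma time_filter_seqP (f : R -> R) (t l d : R) : 0 < d ->
  (forall u : nat -> R, (forall k, [/\ I (u k), u k != t & `|u k - t| < d]) ->
     u k @[k --> \oo] --> t -> f (u k) @[k --> \oo] --> l) ->
  f s @[s --> within I t^'] --> l.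
Proof.
move=> d0 fu; apply: contrapT => fl.
(* If the limit fails, bad times exist at every scale: the bound [d] keeps them in the tested range,
   and [k.+1%:R^-1] makes the chosen sequence tend to [t]. *)
have [e e0 He] : exists2 e, 0 < e & forall k : nat, exists s,
    [/\ I s, s != t, `|s - t| < Num.min d k.+1%:R^-1 & e <= `|l - f s|].
  apply: contrapT => H; apply: fl; apply/cvgrPdist_lt => e e0.
  apply: contrapT => fe; apply: H; exists e => // k.
  apply: contrapT => Hk; apply: fe; rewrite near_withinE.
  have r0 : 0 < Num.min d k.+1%:R^-1 by rewrite lt_min d0 invr_gt0/=.
  apply/nbhs_ballP; exists (Num.min d k.+1%:R^-1) => //= s ts st Is.
  rewrite ltNge; apply/negP => es; apply: Hk; exists s; split => //.
  by move: ts; rewrite -ball_normE /ball_/= distrC.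
have [u uP] := choice He.
have ut : u k @[k --> \oo] --> t.
  apply/cvgrPdist_lt => eps eps0; near=> k.
  have [_ _ + _] := uP k; rewrite distrC lt_min => /andP[_ /lt_trans]; apply.
  by near: k; exact: (near_infty_natSinv_lt (PosNum eps0)).
have uI k : [/\ I (u k), u k != t & `|u k - t| < d].
  by have [? ? + _] := uP k; rewrite lt_min => /andP[? _].
have := fu u uI ut; move=> /cvgrPdist_lt/(_ e e0)[N _ /(_ N (leqnn N))].
by have [_ _ _ +] := uP N; rewrite leNgt => /negP.
Unshelve. all: by end_near. Qed.

Context d (Y : measurableType d) (nu : {measure set Y -> \bar R}).
Variables (E : set Y) (H : R -> Y -> R) (dH : Y -> R) (t M r : R).
Hypotheses (mE : measurable E) (finE : (nu E < +oo)%E) (It : I t) (r0 : 0 < r).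
Hypothesis mH : forall s, I s -> measurable_fun E (H s).
Hypothesis mdH : measurable_fun E dH.
Hypothesis H_M : forall s y, I s -> `|s - t| < r -> E y -> `|H s y| <= M.
Hypothesis H_lip : forall s y, I s -> `|s - t| < r -> E y ->
  `|H s y - H t y| <= M * `|s - t|.
Hypothesis H_der : forall y, E y -> has_time_derivative T (H^~ y) t (dH y).

Lemma integrable_slice s : I s -> `|s - t| < r -> nu.-integrable E (EFin \o H s).
Proof.
move=> Is st; apply: measurable_bounded_integrable => //; first exact: mH.
exists M; split; [exact: num_real|move=> x Mx y /= Ey].
exact/ltW/(le_lt_trans (H_M _ _ _)).
Qed.

Let quotient_bound s y : I s -> s != t -> `|s - t| < r -> E y ->
  `|(s - t)^-1 * (H s y - H t y)| <= M.
Proof.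
move=> Is st sr Ey; rewrite normrM normfV ler_pdivrMl ?normr_gt0 ?subr_eq0//.
by rewrite mulrC H_lip.
Qed.

(** The bound [M] on difference quotients passes to their limit, up to an arbitrary [e]. *)
Let derivative_bound y : E y -> `|dH y| <= M.
Proof.
move=> Ey; apply/ler_addgt0Pr => e e0.
have PF := time_filter_proper It.
have := H_der Ey => /cvgrPdist_le/(_ e e0) Hy.
have near_t : \forall s \near within I t^', [/\ I s, s != t & `|s - t| < r].
  rewrite !near_withinE; apply/nbhs_ballP; exists r => //= s.
  by rewrite -ball_normE /ball_/= distrC.
have [s [Hs [Is st sr]]] := filter_ex (filterI Hy near_t).
rewrite -(subrK ((s - t)^-1 *: (H s y - H t y)) (dH y)) addrC.
by rewrite (le_trans (ler_normD _ _))// lerD// quotient_bound.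
Qed.

Lemma integrable_slice_derivative : nu.-integrable E (EFin \o dH).
Proof.
apply: measurable_bounded_integrable => //.
exists M; split; [exact: num_real|move=> x Mx y /= Ey; apply/ltW; apply: le_lt_trans Mx].
exact: derivative_bound.
Qed.

(** The Lipschitz hypothesis bounds all difference quotients by the constant [M], which is
    integrable because [E] has finite measure. *)
Lemma dominated_time_derivative :
  has_time_derivative T (fun s => \int[nu]_(y in E) H s y) t (\int[nu]_(y in E) dH y).
Proof.
have tt : `|t - t| < r by rewrite subrr normr0.
apply: (time_filter_seqP r0) => u uP ut.
have -> : (fun k => (u k - t)^-1 *:
      (\int[nu]_(y in E) H (u k) y - \int[nu]_(y in E) H t y)) =
    (fun k => \int[nu]_(y in E) ((u k - t)^-1 * (H (u k) y - H t y))).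
  apply/funext => k; have [Ik _ kr] := uP k.
  have i1 := integrable_slice Ik kr; have i2 := integrable_slice It tt.
  rewrite -RintegralB// RintegralZl//.
  exact: (integrableB mE i1 i2).
have utI : u k @[k --> \oo] --> within I t^'.
  move=> P tP; have {}tP : nbhs t (fun x => x != t -> I x -> P x) := tP.
  have utP : \forall k \near \oo, u k != t -> I (u k) -> P (u k) := ut _ tP.
  change (\forall k \near \oo, P (u k)).
  by apply: filterS utP => k; have [Ik kt _] := uP k; exact.
apply: fine_cvg.
rewrite fineK; last first.
  exact: (integrable_fin_num mE integrable_slice_derivative).
have [] := @dominated_convergence _ Y R nu E mE
  (fun k y => ((u k - t)^-1 * (H (u k) y - H t y))%:E) (EFin \o dH) (cst M%:E).
- move=> k; have [Ik _ _] := uP k; apply/measurable_EFinP.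
  by apply: measurable_funM => //; apply: measurable_funB; exact: mH.
- exact/measurable_EFinP.
- apply: aeW => y Ey; apply: cvg_EFin; first exact: nearW.
  have Hy : (s - t)^-1 * (H s y - H t y) @[s --> within I t^'] --> dH y := H_der Ey.
  have := cvg_comp _ _ utI Hy; exact.
- apply/integrableP; split; first exact/measurable_EFinP.
  by rewrite integral_cst//= lte_mul_pinfty.
- apply: aeW => y k Ey; rewrite lee_fin; have [Ik kt kr] := uP k.
  exact: quotient_bound.
- by [].
Qed.

End dominated_time_derivative.

(** * Borel measurability and integration in a chart *)

Section borel_measurability.
Variable R : realType.

Lemma measurable_open_set (X : ptopologicalType) (A : set X) :
  open A -> measurable (A : set (borel X)).
Proof. by move=> oA; exact: sub_sigma_algebra. Qed.

Lemma continuous_measurable_borel (X Y : ptopologicalType) (D : set X) (f : X -> Y) :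
  open D -> (forall x, D x -> {for x, continuous f}) ->
  measurable_fun (D : set (borel X)) (f : borel X -> borel Y).
Proof.
move=> oD cf; apply: (@measurability _ _ (borel X) (borel Y) D f (@open Y)) => //.
move=> _ [A oA <-]; apply: measurable_open_set; rewrite openE => x [Dx Ax].
apply: nbhs_setI; first exact: open_nbhs_nbhs.
exact: (cf x Dx _ (open_nbhs_nbhs (conj oA Ax))).
Qed.

Lemma continuous_measurable_real (X : ptopologicalType) (D : set X) (f : X -> R) :
  open D -> (forall x, D x -> {for x, continuous f}) ->
  measurable_fun (D : set (borel X)) (f : borel X -> R).
Proof.
move=> oD cf; apply: (measurability _ (RGenOpens.measurableE R)).
move=> _ [_ [a [b ->] <-]]; apply: measurable_open_set; rewrite openE => x [Dx Ax].
apply: nbhs_setI; first exact: open_nbhs_nbhs.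
apply: (cf x Dx); exact: open_nbhs_nbhs.
Qed.

Lemma lebesgue_rV_bounded n (A : set 'rV[R]_n) (x : 'rV[R]_n) :
  measurable (A : set (borel 'rV[R]_n)) -> (forall y, A y -> `|y - x| < 1) ->
  (@lebesgue_rV R n A < +oo)%E.
Proof.
move=> mA Ax; have [m mE mfin] := lebesgue_rV_spec R n; rewrite mE.
apply: le_lt_trans (mfin (`|x| + 1)); apply: le_measure.
- by rewrite inE.
- by rewrite inE; exact: measurable_rV_ball.
move=> y /Ax yx; rewrite -ball_normE /ball_/= sub0r normrN.
by rewrite -(subrK x y) addrC (le_lt_trans (ler_normD _ _))// ltrD2l.
Qed.

End borel_measurability.

Section chart_measure.
Variables (R : realType) (n : nat) (S : smoothManifold R n) (c : chart R n S).

Lemma measurable_chart_img : measurable (chart_img c : set (borel 'rV[R]_n)).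
Proof. by apply: measurable_open_set; exact: chart_img_open. Qed.

Lemma measurable_chart_inv : measurable_fun (chart_img c : set (borel 'rV[R]_n))
  (chart_inv c : borel 'rV[R]_n -> borel S).
Proof.
apply: continuous_measurable_borel; first exact: chart_img_open.
by move=> x; exact: chart_inv_continuous.
Qed.

(** Turns a forward image into a preimage under [chart_inv], which is continuous on the chart image.
    Measurability of images follows, and the right-hand side has the shape required by the density
    transfer. *)
Lemma chart_imageE (A B : set S) : A `<=` B -> B `<=` chart_dom c ->
  c @` A = c @` B `&` chart_inv c @^-1` A.
Proof.
move=> AB Bc; apply/seteqP; split=> [_ [q Aq <-]|_ [[q Bq <-] /= +]].
  split; first by exists q => //; exact: AB.
  by rewrite /= chart_mapK//; exact/Bc/AB.
by rewrite chart_mapK; [exists q|exact: Bc].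
Qed.

Lemma measurable_chart_image (B : set S) : measurable (B : set (borel S)) ->
  B `<=` chart_dom c -> measurable (c @` B : set (borel 'rV[R]_n)).
Proof.
move=> mB Bc; rewrite (chart_imageE Bc (@subset_refl _ _)).
exact: measurable_chart_inv measurable_chart_img _ mB.
Qed.

Lemma chart_image_img (B : set S) : B `<=` chart_dom c -> c @` B `<=` chart_img c.
Proof. by move=> Bc; exact: image_subset. Qed.

Lemma measurable_chart_inv_on (B : set S) : B `<=` chart_dom c ->
  measurable_fun (c @` B : set (borel 'rV[R]_n))
    (chart_inv c : borel 'rV[R]_n -> borel S).
Proof.
move=> Bc; have mI := measurable_chart_img.
exact: measurable_funS mI (chart_image_img Bc) measurable_chart_inv.
Qed.

Variables (N : nat) (F : S -> R -> 'rV[R]_N) (t : R).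
Variable mu : {measure set (borel S) -> \bar R}.
Hypotheses (ac : atlas c) (hmu : volume_measure F t mu).
Hypothesis dens_cont : forall q, chart_dom c q ->
  {for q, continuous (volume_density F t c)}.

Lemma measurable_chart_density : measurable_fun (chart_img c : set (borel 'rV[R]_n))
  (fun x => volume_density F t c (chart_inv c x)).
Proof.
apply: continuous_measurable_real => [|x cx]; first exact: chart_img_open.
have [cx' _] := chart_imgP cx.
exact: (cvg_comp _ _ (chart_inv_continuous cx) (dens_cont cx')).
Qed.

Lemma measurable_chart_density_on (B : set S) : B `<=` chart_dom c ->
  measurable_fun (c @` B : set (borel 'rV[R]_n))
    (fun x => volume_density F t c (chart_inv c x)).
Proof.
move=> Bc; have mI := measurable_chart_img.
exact: measurable_funS mI (chart_image_img Bc) measurable_chart_density.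
Qed.

Lemma chart_change_of_variables (B : set S) (f : S -> R) :
  measurable (B : set (borel S)) -> B `<=` chart_dom c ->
  measurable_fun (B : set (borel S)) (f : borel S -> R) -> (forall q, 0 <= f q) ->
  (\int[mu]_(q in (B : set (borel S))) (f q)%:E =
   \int[@lebesgue_rV R n]_(x in (c @` B : set (borel 'rV[R]_n)))
     (f (chart_inv c x) * volume_density F t c (chart_inv c x))%:E)%E.
Proof.
move=> mB Bc mf f0.
have mE := measurable_chart_image mB Bc.
apply: (@ge0_integral_density_transfer _ _ (borel S) (borel 'rV[R]_n) R mu
  (@lebesgue_rV R n) B (c @` B) (chart_inv c)) => //.
- exact: measurable_chart_inv_on.
- exact: measurable_chart_density_on.
- by move=> _ [q Bq <-]; rewrite /= chart_mapK//; exact: Bc.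
- by move=> y _; exact: sqrtr_ge0.
- move=> A mA AB; rewrite (hmu ac mA (subset_trans AB Bc)).
  by rewrite (chart_imageE AB Bc).
Qed.

End chart_measure.

(** * Pointwise first variation *)

(* Otherwise unification compares two distinct directional derivatives by
   unfolding their limits. *)
Local Opaque derive delta_mx.

Section first_variation.
Variables (R : realType) (n N : nat) (S : smoothManifold R n) (T : \bar R).
Variables (V : 'rV[R]_N) (F : S -> R -> 'rV[R]_N).
Hypothesis hF : smooth_family F T.
Hypothesis himm : forall t, time_interval T t -> immersion F t.
Hypothesis hflow : forall p t, time_interval T t ->
  has_time_derivative T (F p) t
    (mean_curvature F t p + tangential_part F t p V).
Let I := time_interval T.
Let e_ (i : 'I_n) : 'rV[R]_n := delta_mx 0 i.

Let vel s q := mean_curvature F s q + tangential_part F s q V.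

Lemma velocity_defect s q :
  V - vel s q = - (mean_curvature F s q - normal_part F s q V).
Proof.
rewrite opprB -[X in X - _ = _](tan_nor_proj (frame F s (chart_at q) q) V).
rewrite /vel /tangential_part /normal_part; set a := tan_proj _ _.
by rewrite [a + _]addrC opprD addrACA subrr addr0.
Qed.

(** In [chart_at q], where the curvature and projections are computed, normality is immediate. The
    frame in [c] is a matrix times the frame there, so orthogonality passes to it. *)
Lemma velocity_defect_normal c q s : atlas c -> chart_dom c q -> I s ->
  (V - vel s q) *m (frame F s c q)^T = 0.
Proof.
move=> ac cq Is; set d := chart_at q.
have dq : chart_dom d q := chart_at_dom q.
have [K KE] := frame_change hF ac (chart_at_atlas q) cq dq.
rewrite KE// trmx_mul mulmxA velocity_defect mulNmx mulmxBl nor_proj_normal subr0.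
rewrite mulmx_suml big1 ?oppr0 ?mul0mx// => i _.
rewrite mulmx_suml big1// => j _.
by rewrite -scalemxAl nor_proj_normal scaler0.
Qed.

Section fixed_chart.
Variables (c : chart R n S) (U : set ('rV[R]_n * R)) (g : 'rV[R]_n * R -> 'rV[R]_N).
Hypotheses (ac : atlas c) (gext : local_extension T F c U g).
Let oU : open U. Proof. by have [] := gext. Qed.
Let gU : smooth_open U g. Proof. by have [] := gext. Qed.

Let Dt := 'D_(0, 1) g.
Let Dx i := 'D_(e_ i, 0) g.
Let Dx_diff i z : U z -> differentiable (Dx i) z.
Proof. exact: (gU [:: (e_ i, 0)]). Qed.
Let Dt_diff z : U z -> differentiable Dt z.
Proof. exact: (gU [:: (0, 1)]). Qed.

Lemma ext_velocity q s : chart_dom c q -> U (c q, s) -> I s -> vel s q = Dt (c q, s).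
Proof.
move=> cq Uq Is.
exact: (time_derivative_unique Is (@hflow q s Is) (ext_time_derivative gext cq Uq Is)).
Qed.

Lemma ext_normal x s j : U (x, s) -> I s -> dotp (V - Dt (x, s)) (Dx j (x, s)) = 0.
Proof.
move=> Uxs Is.
have [cq xE] : chart_dom c (chart_inv c x) /\ c (chart_inv c x) = x.
  by apply: chart_imgP; have [_ _ /(_ _ Uxs)[]] := gext.
move: (chart_inv c x) cq xE => q cq xE; move: Uxs; rewrite -xE => Uq.
rewrite -ext_velocity//.
have -> : Dx j (c q, s) = row j (frame F s c q) by rewrite (ext_frame gext)// rowK.
by rewrite dotp_row velocity_defect_normal// mxE.
Qed.

(** At the fixed admissible time [s], [ext_normal] holds for all [y] near [x], so the function being
    differentiated along [e_ i] vanishes identically near [x]. *)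
Lemma ext_normal_derive x s i j : U (x, s) -> I s ->
  dotp ('D_(e_ i, 0) Dt (x, s)) (Dx j (x, s)) =
  dotp (V - Dt (x, s)) ('D_(e_ i, 0) (Dx j) (x, s)).
Proof.
move=> Uxs Is.
have D1 := is_derive_space (e_ i) (Dt_diff Uxs).
have D2 := is_derive_space (e_ i) (Dx_diff j Uxs).
have := is_derive_dotp (is_deriveB (is_derive_cst V x (e_ i)) D1) D2.
move=> [_]; rewrite (near_eq_derive (g := cst 0)); last first.
  by apply: filterS (near_slice gext Uxs) => y Uy; exact: ext_normal.
rewrite derive_cst sub0r dotpNl => /esym/eqP.
by rewrite addrC subr_eq0 => /eqP ->.
Qed.

(** Built from [g] rather than [F], so it is defined and varies smoothly also at the inadmissible
    times of [U], and ordinary time derivatives make sense. *)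
Definition ext_gram z : 'M[R]_n := \matrix_(i, j) dotp (Dx i z) (Dx j z).

Lemma ext_gramE z : ext_gram z = (\matrix_i Dx i z) *m (\matrix_i Dx i z)^T.
Proof.
apply/matrixP => i j; rewrite !mxE dotpE.
by apply: eq_bigr => k _; rewrite !mxE.
Qed.

Lemma ext_gram_tr z : (ext_gram z)^T = ext_gram z.
Proof. by apply/matrixP => i j; rewrite !mxE; exact: dotpC. Qed.

Lemma ext_metric q s : chart_dom c q -> U (c q, s) -> I s ->
  induced_metric F s c q = ext_gram (c q, s).
Proof.
move=> cq Uq Is; rewrite /induced_metric (ext_frame gext)//.
by apply/matrixP => i j; rewrite !mxE !rowK.
Qed.

Lemma ext_row_free q s : chart_dom c q -> U (c q, s) -> I s ->
  row_free (\matrix_i Dx i (c q, s)).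
Proof. by move=> cq Uq Is; rewrite -(ext_frame gext)//; exact: himm. Qed.

Definition ext_density z : R := Num.sqrt (\det (ext_gram z)).

Lemma ext_volume_density q s : chart_dom c q -> U (c q, s) -> I s ->
  volume_density F s c q = ext_density (c q, s).
Proof. by move=> cq Uq Is; rewrite /volume_density ext_metric. Qed.

Definition ext_weight z : R := expR (dotp (g z - z.2 *: V) V).

Lemma ext_weightE q s : chart_dom c q -> U (c q, s) -> I s ->
  weight F V s q = ext_weight (c q, s).
Proof.
move=> cq Uq Is; rewrite /weight /ext_weight/= -(ext_local_repr gext)//.
by rewrite /local_repr chart_mapK.
Qed.

Lemma is_derive_ext_density q s : chart_dom c q -> U (c q, s) -> I s ->
  is_derive s 1 (fun r => ext_density (c q, r))
    (ext_density (c q, s) * \sum_i \sum_j invmx (ext_gram (c q, s)) i j *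
       dotp (V - Dt (c q, s)) ('D_(e_ i, 0) (Dx j) (c q, s))).
Proof.
move=> cq Uq Is; set x := c q in Uq *.
have rf := ext_row_free cq Uq Is.
have det0 : 0 < \det (ext_gram (x, s)) by rewrite ext_gramE gram_det_gt0.
pose a i j := dotp ('D_(e_ i, 0) Dt (x, s)) (Dx j (x, s)).
have dDx i : is_derive s 1 (fun r => Dx i (x, r)) ('D_(e_ i, 0) Dt (x, s)).
  (* The time derivative of the frame is the space derivative of the velocity; only the latter is
     controlled by the flow equation. *)
  have swap : 'D_(0, 1) (Dx i) (x, s) = 'D_(e_ i, 0) Dt (x, s).
    exact: (smooth_derive_swap _ _ oU gU Uq).
  exact: (is_derive_congr (is_derive_in_time (Dx_diff i Uq)) (fun=> erefl) swap).
have dG i j : is_derive s 1 (fun r => ext_gram (x, r) i j)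
    ((\matrix_(i, j) (a i j + a j i)) i j).
  apply: (is_derive_congr (is_derive_dotp (dDx i) (dDx j))) => [r|]; first by rewrite mxE.
  by rewrite mxE; apply: (congr1 (+%R _)); exact: dotpC.
have := is_derive1_comp (is_derive1_sqrt det0) (is_derive_det dG).
move=> D; apply: (is_derive_congr D) => //.
under eq_bigr do under eq_bigr do rewrite mxE.
rewrite (trace_cofactor a) ?ext_gram_tr//; last by rewrite ext_gramE gram_unit.
have sumE : \sum_i \sum_j invmx (ext_gram (x, s)) i j * a i j =
    \sum_i \sum_j invmx (ext_gram (x, s)) i j *
      dotp (V - Dt (x, s)) ('D_(e_ i, 0) (Dx j) (x, s)).
  apply: eq_bigr => i _; apply: eq_bigr => j _.
  exact: (congr1 ( *%R _) (ext_normal_derive i j Uq Is)).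
exact: etrans (congr1 (fun X => _ * (2 * _ * X)) sumE) (sqrt_derivative_rescale _ det0).
Qed.

Lemma is_derive_ext_weight x s : U (x, s) ->
  is_derive s 1 (fun r => ext_weight (x, r))
    (ext_weight (x, s) * dotp (Dt (x, s) - V) V).
Proof.
move=> Uxs.
have D1 : is_derive s 1 (fun r => g (x, r)) (Dt (x, s)).
  exact: is_derive_in_time (gU [::] Uxs).
have D2 : is_derive s 1 (fun r : R => r *: V) V.
  have i h : (h *: (1 : R^o) + s) *: V = h *: V + s *: V.
    by rewrite scalerDl [h *: _]mulr1.
  exact: (@derive_reparam R _ R^o _ id (fun r : R => r *: V) s 1 V V i
    (is_derive_id _ _)).
have D3 := is_derive_dotp (is_deriveB D1 D2) (is_derive_cst V s 1).
have := is_derive1_comp (is_derive_expR _) D3.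
move=> D; apply: (is_derive_congr D) => //; congr (_ * _).
by rewrite /cst [X in _ + X](_ : _ = 0) ?addr0// dotpC /dotp mul0mx mxE.
Qed.

End fixed_chart.

Lemma induced_metricE s c q :
  induced_metric F s c q = frame F s c q *m (frame F s c q)^T.
Proof.
by apply/matrixP => i j; rewrite !mxE dotpE; apply: eq_bigr => k _; rewrite !mxE.
Qed.

(** Under [frame_change] the Gram determinant is multiplied by the square of [\det K]. *)
Lemma volume_density_change c d q : atlas c -> atlas d ->
  chart_dom c q -> chart_dom d q ->
  exists k, forall s, I s -> volume_density F s c q = k * volume_density F s d q.
Proof.
move=> ac ad cq dq; have [K KE] := frame_change hF ac ad cq dq.
exists `|\det K| => s Is; rewrite /volume_density !induced_metricE KE// trmx_mul.
rewrite mulmxA -[K *m _ *m _]mulmxA !det_mulmx det_tr mulrAC -expr2.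
by rewrite sqrtrM ?sqr_ge0// sqrtr_sqr.
Qed.

(** In [chart_at p] the trace produced by the density is literally the sum defining
    [mean_curvature], so no invariance of the latter under change of charts is involved. *)
Lemma weighted_density_derivative_chart_at p t : I t ->
  has_time_derivative T
    (fun s => weight F V s p * volume_density F s (chart_at p) p) t
    (- (enorm (mean_curvature F t p - normal_part F t p V) ^+ 2 *
        (weight F V t p * volume_density F t (chart_at p) p))).
Proof.
move=> It; set c := chart_at p.
have ac : atlas c := chart_at_atlas p.
have cp : chart_dom c p := chart_at_dom p.
have [U [g [gext Up]]] := exists_local_extension hF ac cp It.
have nE : \forall s \near t, I s -> weight F V s p * volume_density F s c p =
    ext_weight g (c p, s) * ext_density g (c p, s).
  apply: filterS (near_time_slice gext Up) => s Us Is.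
  by rewrite (ext_weightE gext)// (ext_volume_density gext).
rewrite (nbhs_singleton nE It).
apply: (near_eq_time_derivative It nE).
apply: is_derive_has_time_derivative.
have := is_deriveM (is_derive_ext_weight gext Up)
  (is_derive_ext_density ac gext cp Up It).
move=> D; apply: (is_derive_congr D) => //.
set Y := V - 'D_(0, 1) g (c p, t).
have YE : Y = V - vel t p by rewrite /Y (ext_velocity gext cp Up It).
have Yn : Y *m (frame F t c p)^T = 0 by rewrite YE velocity_defect_normal.
(* [Y] is normal, hence sees only the normal part of the second derivatives. *)
have tE i j : dotp Y ('D_(e_ i, 0) ('D_(e_ j, 0) g) (c p, t)) =
    dotp Y (second_ff F t c p i j).
  rewrite [RHS](dotp_nor_proj _ Yn); apply: (congr1 (dotp Y)).
  exact: esym (ext_derive2 gext (e_ i) (e_ j) Up It).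
have GE := ext_metric gext cp Up It.
have HE : \sum_i \sum_j invmx (ext_gram g (c p, t)) i j *
    dotp Y ('D_(e_ i, 0) ('D_(e_ j, 0) g) (c p, t)) = dotp Y (mean_curvature F t p).
  rewrite [RHS]dotp_sumr; apply: eq_bigr => i _.
  rewrite [RHS]dotp_sumr; apply: eq_bigr => j _.
  by rewrite [RHS]dotpZr GE; exact: (congr1 ( *%R _) (tE i j)).
(* [Y] equals V^perp - H and is normal, so |Y|^2 = <Y, V^perp> - <Y, H> = <Y, V> - <Y, H>. *)
have nE' : enorm (mean_curvature F t p - normal_part F t p V) ^+ 2 =
    dotp Y V - dotp Y (mean_curvature F t p).
  have Yd : Y = normal_part F t p V - mean_curvature F t p.
    by rewrite YE velocity_defect opprB.
  rewrite enorm_sqr -[mean_curvature _ _ _ - _]opprB -Yd dotpNl dotpC dotpNl opprK.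
  rewrite [X in dotp _ X]Yd dotpBr; apply: (congr1 (fun x => x - _)).
  exact: dotp_nor_proj.
rewrite nE' HE -[_ - V]opprB -/Y dotpNl.
move: (dotp Y _) (dotp Y _) (ext_weight _ _) (ext_density _ _) => a b w d.
by rewrite /GRing.scale/=; ring.
Qed.

(* mean_curvature is computed in chart_at p; passing to another chart multiplies
   the density by a factor independent of time. *)
Lemma weighted_density_derivative c p t : atlas c -> chart_dom c p -> I t ->
  has_time_derivative T (fun s => weight F V s p * volume_density F s c p) t
    (- (enorm (mean_curvature F t p - normal_part F t p V) ^+ 2 *
        (weight F V t p * volume_density F t c p))).
Proof.
move=> ac cp It.
have [k kE] := volume_density_change ac (chart_at_atlas p) cp (chart_at_dom p).
have nE s : I s -> weight F V s p * volume_density F s c p =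
    k * (weight F V s p * volume_density F s (chart_at p) p).
  by move=> Is; rewrite kE// mulrCA.
apply: (near_eq_time_derivative It); first by near=> s; exact: nE.
rewrite nE// mulrCA -mulrN.
by have := @time_derivativeZ R T k R _ t _ (@weighted_density_derivative_chart_at p t It).
Unshelve. all: by end_near. Qed.


(** * Continuity of the integrands and local bounds in space-time *)

Let decay s q := enorm (mean_curvature F s q - normal_part F s q V) ^+ 2.

(** The velocity is the time derivative of any extension, so this form gives [decay] the continuity
    of [ext_decay], although the chart used for [mean_curvature] may change abruptly with the
    point. *)
Lemma decayE s q : decay s q = dotp (V - vel s q) (V - vel s q).
Proof. by rewrite /decay enorm_sqr velocity_defect dotpNl dotpC dotpNl opprK. Qed.

Definition ext_decay (g : 'rV[R]_n * R -> 'rV[R]_N) z : R :=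
  dotp (V - 'D_(0, 1) g z) (V - 'D_(0, 1) g z).

Section extension_continuity.
Variables (c : chart R n S) (U : set ('rV[R]_n * R)) (g : 'rV[R]_n * R -> 'rV[R]_N).
Hypotheses (ac : atlas c) (gext : local_extension T F c U g).
Let oU : open U. Proof. by have [] := gext. Qed.
Let gU : smooth_open U g. Proof. by have [] := gext. Qed.

Lemma ext_weight_continuous z : U z -> {for z, continuous (ext_weight g)}.
Proof.
move=> Uz; apply: (cvg_comp _ expR); last exact: continuous_expR.
apply: cvg_dotp; last exact: cvg_cst.
apply: cvgB; first exact: (differentiable_continuous (gU [::] Uz)).
by apply: cvgZr_tmp; exact: cvg_snd.
Qed.

Lemma ext_density_continuous z : U z -> {for z, continuous (ext_density g)}.
Proof.
move=> Uz; apply: (cvg_comp _ Num.sqrt); last exact: sqrt_continuous.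
have Dc i : {for z, continuous ('D_(e_ i, 0) g)}.
  exact: (differentiable_continuous (gU [:: (e_ i, 0)] Uz)).
have gE i j : (fun y => ext_gram g y i j) =
    (fun y => dotp ('D_(e_ i, 0) g y) ('D_(e_ j, 0) g y)).
  by apply/funext => y; exact: mxE.
have gc i j : {for z, continuous (fun y => ext_gram g y i j)}.
  by rewrite gE; exact: (cvg_dotp (Dc i) (Dc j)).
apply: (@cvg_det R _ (nbhs z) _ n (ext_gram g) (ext_gram g z)) => i j.
exact: gc.
Qed.

Lemma ext_decay_continuous z : U z -> {for z, continuous (ext_decay g)}.
Proof.
move=> Uz; have Dc : {for z, continuous (fun z => V - 'D_(0, 1) g z)}.
  have Dtc : {for z, continuous ('D_(0, 1) g)}.
    exact: (differentiable_continuous (gU [:: (0, 1)] Uz)).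
  by apply: cvgB; [exact: cvg_cst|exact: Dtc].
exact: (cvg_dotp Dc Dc).
Qed.

Lemma near_chart_slice q s : chart_dom c q -> U (c q, s) ->
  \forall q' \near q, chart_dom c q' /\ U (c q', s).
Proof.
move=> cq Uq; have cc := chart_map_continuous cq.
exact: nbhs_setI (near_chart_dom cq) (cc _ (near_slice gext Uq)).
Qed.

Lemma continuous_from_extension (W : topologicalType) (f : S -> W)
    (h : 'rV[R]_n * R -> W) q s :
  chart_dom c q -> U (c q, s) -> {for (c q, s), continuous h} ->
  (forall q', chart_dom c q' -> U (c q', s) -> f q' = h (c q', s)) ->
  {for q, continuous f}.
Proof.
move=> cq Uq hc fh.
have c1 : {for q, continuous (fun q' => h (c q', s))}.
  apply: (cvg_comp c (fun y => h (y, s)) (chart_map_continuous cq)).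
  apply: (cvg_comp (fun y => (y, s)) h _ hc).
  exact: (differentiable_continuous (differentiable_pairl (c q) s)).
have {}c1 : h (c q', s) @[q' --> q] --> h (c q, s) := c1.
rewrite -(fh q cq Uq) in c1; apply: cvg_trans c1; apply: near_eq_cvg.
by apply: filterS (near_chart_slice cq Uq) => q' [cq' Uq']; rewrite fh.
Qed.

End extension_continuity.

Lemma weight_continuous s : I s -> continuous (weight F V s).
Proof.
move=> Is q; have ac := chart_at_atlas q; have cq := chart_at_dom q.
have [U [g [gext Uq]]] := exists_local_extension hF ac cq Is.
apply: (continuous_from_extension gext cq Uq (ext_weight_continuous gext Uq)).
by move=> q' cq' Uq'; exact: (ext_weightE gext cq' Uq' Is).
Qed.

Lemma decay_continuous s : I s -> continuous (decay s).
Proof.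
move=> Is q; have ac := chart_at_atlas q; have cq := chart_at_dom q.
have [U [g [gext Uq]]] := exists_local_extension hF ac cq Is.
apply: (continuous_from_extension gext cq Uq (ext_decay_continuous gext Uq)).
by move=> q' cq' Uq'; rewrite decayE (ext_velocity gext cq' Uq' Is).
Qed.

Lemma volume_density_continuous c s q : atlas c -> I s -> chart_dom c q ->
  {for q, continuous (volume_density F s c)}.
Proof.
move=> ac Is cq; have [U [g [gext Uq]]] := exists_local_extension hF ac cq Is.
apply: (continuous_from_extension gext cq Uq (ext_density_continuous gext Uq)).
by move=> q' cq' Uq'; exact: (ext_volume_density gext cq' Uq' Is).
Qed.

(** The first bound gives integrability; the second bounds the time derivative of the weighted
    density. Both come from continuity of the extended quantities at one point of space-time,
    uniformly on a product neighbourhood. *)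
Lemma local_bounds c p t : atlas c -> I t -> chart_dom c p ->
  exists M r (O : set S), [/\ 0 < r, open O, O p, O `<=` chart_dom c &
    forall q, O q -> `|c q - c p| < 1 /\
      forall s, I s -> `|s - t| < r ->
        `|weight F V s q * volume_density F s c q| <= M /\
        `|decay s q * (weight F V s q * volume_density F s c q)| <= M].
Proof.
move=> ac It cp; have [U [g [gext Up]]] := exists_local_extension hF ac cp It.
have oU : open U by have [] := gext.
pose k z := ext_weight g z * ext_density g z.
have kc : {for (c p, t), continuous k}.
  apply: cvgM; first exact: (ext_weight_continuous gext Up).
  exact: (ext_density_continuous gext Up).
pose dk z := ext_decay g z * k z.
have dkc : {for (c p, t), continuous dk}.
  by apply: cvgM; [exact: (ext_decay_continuous gext Up)|exact: kc].
pose M := Num.max (`|k (c p, t)| + 1) (`|dk (c p, t)| + 1).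
have := nbhs_setI (open_nbhs_nbhs (conj oU Up))
  (nbhs_setI (near_bounded kc) (near_bounded dkc)).
move=> /nbhs_ballP[r /= r0 rP].
(* The radius 1 keeps the chart image in a unit ball, hence of finite Lebesgue measure; [r] is the
   radius on which the bounds hold. *)
pose e := Num.min r 1.
have e0 : 0 < e by rewrite lt_min r0 ltr01.
have nO : nbhs p [set q | chart_dom c q /\ ball (c p) e (c q)].
  apply: nbhs_setI (near_chart_dom cp) _.
  by have cc := chart_map_continuous cp; exact: (cc _ (nbhsx_ballx (c p) e e0)).
move: nO; rewrite nbhsE => -[Q [Qo Qp] QP].
exists M, r, Q; split => //; first by move=> q /QP[].
move=> q Qq; have [cq cqe] := QP q Qq; split.
  move: cqe; rewrite -ball_normE /ball_/= distrC => /lt_le_trans; apply.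
  by rewrite ge_min lexx orbT.
move=> s Is st.
have [Uq [kM dkM]] : (U `&` ([set x | `|k x| <= `|k (c p, t)| + 1] `&`
    [set x | `|dk x| <= `|dk (c p, t)| + 1])) (c q, s).
  apply: rP; split => /=.
    by apply: le_ball cqe; rewrite ge_min lexx.
  by rewrite -ball_normE /ball_/= distrC.
rewrite decayE (ext_velocity gext cq Uq Is) (ext_weightE gext cq Uq Is).
rewrite (ext_volume_density gext cq Uq Is).
by split; [apply: le_trans kM _|apply: le_trans dkM _]; rewrite le_max lexx ?orbT.
Qed.


(** * First variation of the weighted volume *)

Section weighted_volume_derivative.
Variable mu : R -> {measure set (borel S) -> \bar R}.
Hypothesis hmu : forall t, I t -> volume_measure F t (mu t).
Variable t : R.
Hypothesis It : I t.

(** Integrability, also at nearby times, is carried along because the real-valued integral is split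
    over a disjoint union only for integrable functions. *)
Definition differentiable_piece (B : set (borel S)) : Prop :=
  [/\ measurable B,
    exists2 r, 0 < r & forall s, I s -> `|s - t| < r ->
      (mu s).-integrable B (EFin \o weight F V s),
    (mu t).-integrable B (EFin \o (fun q => decay t q * weight F V t q)) &
    has_time_derivative T (weighted_volume F V mu B) t
      (- \int[mu t]_(q in B) (decay t q * weight F V t q))].

Lemma differentiable_pieceU (A B : set (borel S)) : A `&` B = set0 ->
  differentiable_piece A -> differentiable_piece B -> differentiable_piece (A `|` B).
Proof.
move=> AB [mA [rA rA0 iA] jA dA] [mB [rB rB0 iB] jB dB].
have iU s : I s -> `|s - t| < Num.min rA rB ->
    (mu s).-integrable (A `|` B) (EFin \o weight F V s).
  move=> Is; rewrite lt_min => /andP[sA sB].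
  by apply: integrable_setU => //; [exact: iA|exact: iB].
have r0 : 0 < Num.min rA rB by rewrite lt_min rA0.
have jU := integrable_setU mA mB AB jA jB.
split; [exact: measurableU|by exists (Num.min rA rB)|exact: jU|].
rewrite Rintegral_setU//; last exact/disj_set2P.
rewrite opprD; apply: (near_eq_time_derivative It); last exact: time_derivativeD dA dB.
apply/nbhs_ballP; exists (Num.min rA rB) => //= s.
rewrite -ball_normE /ball_/= distrC => st Is.
rewrite /weighted_volume Rintegral_setU//; [exact: iU|exact/disj_set2P].
Qed.

Lemma measurable_weight s (B : set (borel S)) : I s -> measurable B ->
  measurable_fun B (weight F V s : borel S -> R).
Proof.
move=> Is mB; apply: (@measurable_funS _ _ (borel S) R setT) => //.
by apply: continuous_measurable_real => [|q _]; [exact: openT|exact: weight_continuous].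
Qed.

Lemma measurable_decay (B : set (borel S)) : measurable B ->
  measurable_fun B (decay t : borel S -> R).
Proof.
move=> mB; apply: (@measurable_funS _ _ (borel S) R setT) => //.
by apply: continuous_measurable_real => [|q _]; [exact: openT|exact: decay_continuous].
Qed.

(** All Borel subsets of [O] are covered, since the pieces cut from a domain by a finite cover are
    in general not open. *)
Lemma local_differentiable_piece p :
  exists O : set S, [/\ open O, O p &
    forall B : set (borel S), measurable B -> B `<=` O -> differentiable_piece B].
Proof.
set c := chart_at p; have ac : atlas c := chart_at_atlas p.
have cp : chart_dom c p := chart_at_dom p.
have [M [r [Q [r0 oQ Qp Qc QP]]]] := local_bounds ac It cp.
exists Q; split => // B mB BQ.
have Bc : B `<=` chart_dom c := subset_trans BQ Qc.
pose E : set (borel 'rV[R]_n) := c @` B.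
have mE : measurable E := measurable_chart_image mB Bc.
have finE : (@lebesgue_rV R n E < +oo)%E.
  by apply: (lebesgue_rV_bounded (x := c p)) => // _ [q Bq <-]; have [] := QP q (BQ q Bq).
pose H s (x : borel 'rV[R]_n) : R :=
  weight F V s (chart_inv c x) * volume_density F s c (chart_inv c x).
pose dH (x : borel 'rV[R]_n) : R := - (decay t (chart_inv c x) * H t x).
have EQ x : E x -> Q (chart_inv c x).
  by move=> [q Bq <-]; rewrite chart_mapK; [exact: BQ|exact: Bc].
have minv : measurable_fun E (chart_inv c : borel 'rV[R]_n -> borel S).
  exact: measurable_chart_inv_on Bc.
have mT : measurable (setT : set (borel S)) := measurableT.
have mdens s : I s ->
    measurable_fun E (fun x => volume_density F s c (chart_inv c x) : R).
  move=> Is; apply: measurable_chart_density_on => // q cq.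
  exact: volume_density_continuous.
have mH s : I s -> measurable_fun E (H s).
  move=> Is; apply: measurable_funM; last exact: mdens.
  exact: (measurableT_comp (measurable_weight Is mT) minv).
have mdH : measurable_fun E dH.
  apply: measurableT_comp => //; apply: measurable_funM; last exact: mH.
  exact: (measurableT_comp (measurable_decay mT) minv).
have H_der s x : E x -> I s -> has_time_derivative T (H^~ x) s
    (- (decay s (chart_inv c x) * H s x)).
  by move=> /EQ/Qc cx Is; exact: weighted_density_derivative.
have H_M s x : I s -> `|s - t| < r -> E x -> `|H s x| <= M.
  by move=> Is st /EQ/QP[_ /(_ s Is st)[]].
have tt : `|t - t| < r by rewrite subrr normr0.
have H_lip s x : I s -> `|s - t| < r -> E x -> `|H s x - H t x| <= M * `|s - t|.
  move=> Is st Ex.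
  pose l s' := - (decay s' (chart_inv c x) * H s' x).
  have dl s' : I s' -> `|s' - t| < r ->
      has_time_derivative T (H^~ x) s' (l s') /\ `|l s'| <= M.
    move=> Is' st'; split; first exact: H_der.
    by have [_ /(_ s' Is' st')[_]] := QP _ (EQ x Ex); rewrite normrN.
  (* Every time between [s] and [t] is admissible and within [r] of [t], so the derivative bound
     holds on the whole segment; the two orders are treated separately. *)
  have [ts|/ltW st0] := leP t s.
    have dts s' : t <= s' <= s -> has_time_derivative T (H^~ x) s' (l s') /\ `|l s'| <= M.
      move=> ts's; apply: dl; first exact: (time_interval_between It Is ts's).
      apply: le_lt_trans st; have /andP[ts' s's] := ts's.
      by rewrite !ger0_norm ?subr_ge0// lerD2r.
    exact: (time_derivative_lipschitz It Is ts dts).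
  have dst s' : s <= s' <= t -> has_time_derivative T (H^~ x) s' (l s') /\ `|l s'| <= M.
    move=> ss't; apply: dl; first exact: (time_interval_between Is It ss't).
    apply: le_lt_trans st; have /andP[ss' s't] := ss't.
    by rewrite !ler0_norm ?subr_le0// lerN2 lerD2r.
  rewrite distrC [`|s - t|]distrC.
  exact: (time_derivative_lipschitz Is It st0 dst).
have transfer s (f : S -> R) : I s -> measurable_fun B (f : borel S -> R) ->
    (forall q, 0 <= f q) ->
    (\int[mu s]_(q in B) (f q)%:E = \int[@lebesgue_rV R n]_(x in E)
     (f (chart_inv c x) * volume_density F s c (chart_inv c x))%:E)%E.
  move=> Is mf f0; apply: chart_change_of_variables => //; first exact: hmu.
  by move=> q cq; exact: volume_density_continuous.
have iH s : I s -> `|s - t| < r -> (@lebesgue_rV R n).-integrable E (EFin \o H s).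
  exact: (integrable_slice mE finE mH H_M).
have idH : (@lebesgue_rV R n).-integrable E (EFin \o dH).
  by apply: (integrable_slice_derivative mE finE It r0 mdH H_lip) => x Ex; exact: H_der.
have w0 s q : 0 <= weight F V s q by exact: expR_ge0.
have d0 q : 0 <= decay t q * weight F V t q by rewrite mulr_ge0// exprn_ge0// sqrtr_ge0.
have mdw : measurable_fun B ((fun q => decay t q * weight F V t q) : borel S -> R).
  by apply: measurable_funM; [exact: measurable_decay|exact: measurable_weight].
have H0 s x : 0 <= H s x by rewrite mulr_ge0 ?w0 ?sqrtr_ge0.
have iB s : I s -> `|s - t| < r -> (mu s).-integrable B (EFin \o weight F V s).
  move=> Is st; have mw := measurable_weight Is mB.
  exact: (integrable_ge0_transfer mw (fun q _ => w0 s q) (fun x _ => H0 s x)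
    (transfer s _ Is mw (w0 s)) (iH s Is st)).
have trdw : (\int[mu t]_(q in B) (decay t q * weight F V t q)%:E =
    \int[@lebesgue_rV R n]_(x in E) (- dH x)%:E)%E.
  rewrite transfer//; apply: eq_integral => x _.
  by rewrite /dH opprK /H mulrA.
have dH0 x : 0 <= - dH x.
  by rewrite /dH opprK mulr_ge0// exprn_ge0// sqrtr_ge0.
have jB : (mu t).-integrable B (EFin \o (fun q => decay t q * weight F V t q)).
  apply: (integrable_ge0_transfer mdw (fun q _ => d0 q) (fun x _ => dH0 x) trdw).
  by have := integrableN idH.
split=> //; first by exists r.
have -> : - (\int[mu t]_(q in B) (decay t q * weight F V t q)) =
    \int[@lebesgue_rV R n]_(x in E) dH x.
  transitivity (- (\int[@lebesgue_rV R n]_(x in E) (-1 * dH x))); last first.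
    by rewrite RintegralZl// mulN1r opprK.
  rewrite /Rintegral trdw; congr (- fine _).
  by apply: eq_integral => x _; rewrite mulN1r.
apply: (near_eq_time_derivative It); last first.
  exact: (dominated_time_derivative mE finE It r0 mH mdH H_M H_lip
    (fun x Ex => H_der t x Ex It)).
apply/nbhs_ballP; exists r => //= s; rewrite -ball_normE /ball_/= distrC => st Is.
by rewrite /weighted_volume /Rintegral transfer//; exact: measurable_weight.
Qed.

(** Induction on the cover: [B] is cut into its part inside [O p], and the remainder, which the
    other sets still cover. *)
Lemma covered_differentiable_piece (O : S -> set S) (l : seq S) (B : set (borel S)) :
  (forall p, open (O p) /\ forall A : set (borel S), measurable A -> A `<=` O p ->
     differentiable_piece A) ->
  measurable B -> B `<=` [set q | exists2 p, p \in l & O p q] -> differentiable_piece B.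
Proof.
move=> OP; elim: l B => [|p l IH] B mB Bl.
  (* With no covering set left [B] is empty, hence contained in [O point], where [point] is an
     arbitrary element. *)
  have [_] := OP point; apply => // q /Bl[p].
  by rewrite in_nil.
have [ openO pieceO] := OP p.
have mO : measurable (O p : set (borel S)) by exact: measurable_open_set.
rewrite -(setUIDK B (O p)); apply: differentiable_pieceU.
- by apply/seteqP; split => // q [[_ ?] [_]].
- by apply: pieceO; [exact: measurableI|exact: subIsetr].
- apply: IH; first exact: measurableD.
  move=> q [/Bl[p' + Oq] nOq]; rewrite inE => /predU1P[pp'|p'l]; last by exists p'.
  by rewrite pp' in Oq.
Qed.

Lemma weighted_volume_derivative (D : set S) : relatively_compact_domain D ->
  has_time_derivative T (weighted_volume F V mu D) t
    (- \int[mu t]_(q in (D : set (borel S))) (decay t q * weight F V t q)).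
Proof.
move=> [ openD _ cD]; have [ Q QP] := choice local_differentiable_piece.
(* The finite subcover is taken for the closure of [D]; the integral is over the open, hence Borel,
   set [D] inside it. *)
rewrite compact_cover in cD.
have [||l _ cl] := cD S setT Q.
- by move=> p _; have [] := QP p.
- by move=> q _; exists q => //; have [] := QP q.
have [|||_ _ _] // := @covered_differentiable_piece Q (finmap.enum_fset l) D.
- by move=> p; have [? _ ?] := QP p.
- exact: measurable_open_set.
- by move=> q /subset_closure/cl[p pl Oq]; exists p.
Qed.

End weighted_volume_derivative.

End first_variation.

Theorem theorem1p1 (R : realType) (n N : nat) (S : smoothManifold R n)
    (T : \bar R) (hT : (0 < T)%E) (V : 'rV[R]_N) (F : S -> R -> 'rV[R]_N)
    (hF : smooth_family F T)
    (himm : forall t, time_interval T t -> immersion F t)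
    (hcomplete : forall t, time_interval T t -> complete_induced_metric F t)
    (hflow : forall p t, time_interval T t ->
       has_time_derivative T (F p) t
         (mean_curvature F t p + tangential_part F t p V))
    (mu : R -> {measure set (borel S) -> \bar R})
    (hmu : forall t, time_interval T t -> volume_measure F t (mu t)) :
  (forall t, time_interval T t ->
   forall (p : S) (c : chart R n S), atlas c -> chart_dom c p ->
     has_time_derivative T
       (fun s => weight F V s p * volume_density F s c p) t
       (- (enorm (mean_curvature F t p - normal_part F t p V) ^+ 2 *
           (weight F V t p * volume_density F t c p)))) /\
  (forall D : set S, relatively_compact_domain D ->
   forall t, time_interval T t ->
     has_time_derivative T (weighted_volume F V mu D) t
       (- \int[mu t]_(p in (D : set (borel S)))
            (enorm (mean_curvature F t p - normal_part F t p V) ^+ 2 *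
             weight F V t p))).
Proof.
split=> [t It p c ac cp|D relcompD t It].
  exact: weighted_density_derivative.
exact: (@weighted_volume_derivative R n N S T V F).
Qed.
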